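(* Let $b=[w]\in B_n$ with $w\in W_n$. Then the problem of whether $b$ has a compact SCA representation is decidable.
   Context: **Braids.** $W_n$ is the set of finite words in the symbols $\sigma_1^{\pm1},\dots,\sigma_{n-1}^{\pm1}$ ($1$ is the empty word). The braid group $B_n$ is the quotient of $W_n$ by the relations $\sigma_i\sigma_i^{-1}=\sigma_i^{-1}\sigma_i=1$, $\sigma_i\sigma_j=\sigma_j\sigma_i$ for $|i-j|>1$, and $\sigma_i\sigma_{i+1}\sigma_i=\sigma_{i+1}\sigma_i\sigma_{i+1}$; $[w]$ is the class of $w$. **Cells.** A cell occupies two adjacent integer positions $(j,j+1)$ and is in one of eight states: $[N_j,N_{j+1}]$ (empty); $[s_j^{(i)},N_{j+1}]$, $[N_j,s_{j+1}^{(i)}]$, $[r_j^{(i)},N_{j+1}]$, $[N_j,l_{j+1}^{(i)}]$ (one strand); $[s_j^{(t)},s_{j+1}^{(t+1)}]$ (two straight strands); $[r_j^{(t)},l_{j+1}^{(t+1)}]$ (crossing of kind $T_1$, strand $t$ over strand $t+1$); $\overline{[r_j^{(t)},l_{j+1}^{(t+1)}]}$ (crossing of kind $T_2$, strand $t+1$ over strand $t$). Superscripts are strand numbers and the subscript is the position at which the strand enters, called the position of the strand in that generation. A strand marked $s$ (straight) leaves at the position where it enters, $r$ goes from $j$ to $j+1$, and $l$ goes from $j+1$ to $j$; strands marked $r$ or $l$ are said to turn. **Grid patterns.** An $n$-strand generation is a row of cells tiling the integer positions, all left positions having the same parity, containing exactly $n$ strands numbered $1,\dots,n$ from left to right. A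 grid pattern on $n$ strands is a finite or infinite list of $n$-strand generations (drawn upwards); $G_n^*$ is the set of finite ones (including the empty list). A pattern $g\in G_n^*$ is compact if in each generation the position of the rightmost strand minus the position of the leftmost strand is $n-1$. **Continuity and rules.** For adjacent cells $A$ at $(j,j+1)$, $B$ at $(j+2,j+3)$ of a generation, their child is the cell at $(j+1,j+2)$ of the next generation. $A$ sends a strand to the child if a strand leaves $A$ at $j+1$; $B$ does if a strand leaves $B$ at $j+2$. A grid pattern is continuous if the cells of each non-first generation are the children of adjacent pairs of the previous one and, for every adjacent pair $A,B$ (empty cells included) of a non-last generation, the left (right) position of the child is occupied iff $A$ (respectively $B$) sends a strand to it. A turning rule is a function $\tau:\{S,T,N\}^2\to\{S,T\}$ (the value at $(N,N)$ being irrelevant); it is a turning rule of a continuous pattern if for each adjacent pair $A,B$ with nonempty child the strands of the child are straight when $\tau(\alpha,\beta)=S$ and all turn when $\tau(\alpha,\beta)=T$, where $\alpha$ (resp. $\beta$) is $N$, $S$ or $T$ according as $A$ (resp. $B$) sends no strand, a straight strand, or a turning strand to the child. A crossing rule is a function $\kappa:\{T_1,T_2,0\}^2\to\{T_1,T_2\}$; it is a crossing rule of the pattern if each child that is a crossing has kind $\kappa(\alpha',\beta')$, where $\alpha'$ (resp. $\beta'$) is the kind of crossing in $A$ (resp. $B$), or $0$ if there is none. An SCA pattern is a continuous grid pattern having at least one turning rule and at least one crossing rule; $S_n^*\subseteq G_n^*$ is the set of finite SCA patterns. **Representations.** $\psi:G_n^*\to W_n$ reads the cells of $g$ generation by generation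 (first to last) and left to right within a generation, replacing $[r_j^{(t)},l_{j+1}^{(t+1)}]$ by $\sigma_t$, $\overline{[r_j^{(t)},l_{j+1}^{(t+1)}]}$ by $\sigma_t^{-1}$, and every other cell by the empty word; $\varphi(g)=[\psi(g)]\in B_n$. A compact SCA representation of $b\in B_n$ is a compact $g\in S_n^*$ with $\varphi(g)=b$. The input of the decision problem is the word $w$. *)

(* Defs.v *)
From Stdlib Require Import Relation_Operators.
From mathcomp Require Import all_boot all_order all_algebra.

Set Implicit Arguments.
Unset Strict Implicit.
Unset Printing Implicit Defensive.

(** * Braids

    Generators and strands are indexed from 0: [t : 'I_n.-1] stands for the
    generator sigma_(t+1) and [i : 'I_n] for the strand number i+1. *)

Inductive sign := Pos | Neg.

Definition letter (n : nat) : Type := ('I_n.-1 * sign)%type.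
Definition word (n : nat) : Type := seq (letter n).

Inductive braid_relator (n : nat) : word n -> word n -> Prop :=
| Relator_mulV t : braid_relator [:: (t, Pos); (t, Neg)] [::]
| Relator_mulVl t : braid_relator [:: (t, Neg); (t, Pos)] [::]
| Relator_far (s t : 'I_n.-1) : (s.+1 < t) || (t.+1 < s) ->
    braid_relator [:: (s, Pos); (t, Pos)] [:: (t, Pos); (s, Pos)]
| Relator_braid (s t : 'I_n.-1) : t = s.+1 :> nat ->
    braid_relator [:: (s, Pos); (t, Pos); (s, Pos)]
                  [:: (t, Pos); (s, Pos); (t, Pos)].

Inductive braid_step (n : nat) : word n -> word n -> Prop :=
| Braid_step u v l r : braid_relator l r ->
    braid_step (u ++ l ++ v) (u ++ r ++ v).

(* [braid_eq w w'] is the equality [w] = [w'] in the quotient B_n. *)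
Definition braid_eq (n : nat) : word n -> word n -> Prop :=
  clos_refl_sym_trans (word n) (@braid_step n).

(** * Cells *)

Inductive turning := Straight | Turn.

(* [T1]: strand t over strand t+1; [T2]: strand t+1 over strand t. *)
Inductive crossing := T1 | T2.

(* The cell states at (j, j+1); [Cross T1 t] is [r_j, l_(j+1)] and
   [Cross T2 t] its overlined version.  In the two-strand states, [t] is the
   number of the left strand, the right one being t+1. *)
Inductive cell (n : nat) :=
| Empty                               (* [N, N] *)
| LeftStraight of 'I_n                (* [s, N] *)
| RightStraight of 'I_n               (* [N, s] *)
| LeftTurn of 'I_n                    (* [r, N] *)
| RightTurn of 'I_n                   (* [N, l] *)
| BothStraight of 'I_n.-1             (* [s, s] *)
| Cross of crossing & 'I_n.-1.        (* [r, l] *)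

Arguments Empty {n}.

Section Cells.
Variable n : nat.
Implicit Type C : cell n.

(* The strands of a cell at (j, j+1), left to right, each given by its position
   and its number. *)
Definition cell_strands (j : int) C : seq (int * nat) :=
  match C with
  | Empty => [::]
  | LeftStraight i | LeftTurn i => [:: (j, i : nat)]
  | RightStraight i | RightTurn i => [:: ((j + 1)%R, i : nat)]
  | BothStraight t | Cross _ t => [:: (j, t : nat); ((j + 1)%R, t.+1)]
  end.

Definition left_occupied C : bool :=
  match C with
  | LeftStraight _ | LeftTurn _ | BothStraight _ | Cross _ _ => true
  | _ => false
  end.

Definition right_occupied C : bool :=
  match C with
  | RightStraight _ | RightTurn _ | BothStraight _ | Cross _ _ => true
  | _ => false
  end.

(* [None] for the empty cell. *)
Definition cell_turning C : option turning :=
  match C with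
  | Empty => None
  | LeftStraight _ | RightStraight _ | BothStraight _ => Some Straight
  | LeftTurn _ | RightTurn _ | Cross _ _ => Some Turn
  end.

(* [None] is the value 0 of the crossing rules. *)
Definition cell_crossing C : option crossing :=
  if C is Cross c _ then Some c else None.

(* The strand leaving a cell at its right (resp. left) position, if any;
   [None] is the value N of the turning rules.  A strand entering at the left
   and turning leaves at the right, and conversely. *)
Definition sent_right C : option turning :=
  match C with
  | RightStraight _ | BothStraight _ => Some Straight
  | LeftTurn _ | Cross _ _ => Some Turn
  | _ => None
  end.

Definition sent_left C : option turning :=
  match C with
  | LeftStraight _ | BothStraight _ => Some Straight
  | RightTurn _ | Cross _ _ => Some Turn
  | _ => None
  end.

Definition cell_word C : word n :=
  match C with
  | Cross T1 t => [:: (t, Pos)]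
  | Cross T2 t => [:: (t, Neg)]
  | _ => [::]
  end.

End Cells.

(** * Grid patterns *)

(* A row of cells tiling the integer positions and containing finitely many
   strands is given by a finite window of consecutive cells, the first of which
   has left position [row_start]; every cell outside the window is empty. *)
Record cell_row (n : nat) := CellRow { row_start : int; window : seq (cell n) }.

Section Patterns.
Variable n : nat.
Implicit Types (G : cell_row n) (g : seq (cell_row n)) (k : int).

(* The cells of a row are indexed by [k : int], with index 0 for the first cell
   of the window. *)
Definition left_pos G k : int := (row_start G + k * 2)%R.

Definition cell_at G k : cell n :=
  if k is Posz m then nth Empty (window G) m else Empty.

Definition row_strands G : seq (int * nat) :=
  flatten [seq cell_strands (left_pos G (Posz m)) (cell_at G (Posz m))
          | m <- iota 0 (size (window G))].

(* An n-strand generation: exactly n strands, numbered from left to right. *)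
Definition is_generation G : bool :=
  [seq s.2 | s <- row_strands G] == iota 0 n.

Definition grid_pattern g : bool := all is_generation g.

Definition compact_pattern g : bool :=
  all (fun G => let ps := [seq s.1 | s <- row_strands G] in
         last 0%R ps - head 0%R ps == Posz n.-1)%R g.

Definition consecutive g G G' : Prop :=
  exists g1 g2, g = g1 ++ [:: G, G' & g2].

(* The cell of index [k'] of [G'] is placed as the child of the cells of
   indices [k] and [k + 1] of [G]. *)
Definition child_index G k G' k' : Prop := left_pos G' k' = (left_pos G k + 1)%R.

Definition for_children g (P : cell n -> cell n -> cell n -> Prop) : Prop :=
  forall G G', consecutive g G G' ->
  forall k k', child_index G k G' k' ->
  P (cell_at G k) (cell_at G (k + 1)%R) (cell_at G' k').

Definition continuous_pattern g : Prop :=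
  (forall G G', consecutive g G G' ->
     forall k', exists k, child_index G k G' k') /\
  for_children g (fun A B C =>
    left_occupied C = isSome (sent_right A) /\
    right_occupied C = isSome (sent_left B)).

Definition turning_rule_of g
    (tau : option turning -> option turning -> turning) : Prop :=
  for_children g (fun A B C =>
    forall s, cell_turning C = Some s ->
      s = tau (sent_right A) (sent_left B)).

Definition crossing_rule_of g
    (kappa : option crossing -> option crossing -> crossing) : Prop :=
  for_children g (fun A B C =>
    forall c, cell_crossing C = Some c ->
      c = kappa (cell_crossing A) (cell_crossing B)).

Definition SCA_pattern g : Prop :=
  [/\ grid_pattern g, continuous_pattern g,
      exists tau, turning_rule_of g tau
    & exists kappa, crossing_rule_of g kappa].

Definition psi g : word n :=
  flatten [seq flatten [seq cell_word C | C <- window G] | G <- g].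

Definition has_compact_SCA_representation (w : word n) : Prop :=
  exists g, [/\ SCA_pattern g, compact_pattern g & braid_eq (psi g) w].

End Patterns.

(** * Decidability

    Classical axioms make every predicate decidable by some function of the
    ambient logic, so decidability is stated with partial recursive
    functions. *)

Inductive recfun : nat -> Type :=
| Zero k : recfun k
| Succ : recfun 1
| Proj k of 'I_k : recfun k
| Comp k m of recfun m & ('I_m -> recfun k) : recfun k
| Prec k of recfun k & recfun k.+2 : recfun k.+1
| Mu k of recfun k.+1 : recfun k.

(* [computes f v y]: the value of [f] at the arguments [v] is defined and equal
   to [y].  In [Prec f g], the recursion argument comes first and [s] lists the
   successive values; in [Mu f], all values of [f] before the first zero must be
   defined. *)
Fixpoint computes (k : nat) (f : recfun k) : k.-tuple nat -> nat -> Prop :=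
  match f in recfun k return k.-tuple nat -> nat -> Prop with
  | Zero _ => fun v y => y = 0
  | Succ => fun v y => y = (thead v).+1
  | Proj _ i => fun v y => y = tnth v i
  | Comp k m f gs => fun v y =>
      exists2 u : m.-tuple nat,
        forall i, computes (gs i) v (tnth u i) & computes f u y
  | Prec k f g => fun v y =>
      exists s : nat -> nat,
        [/\ computes f [tuple of behead v] (s 0),
            forall i, i < thead v ->
              computes g [tuple of i :: s i :: behead v] (s i.+1)
          & y = s (thead v)]
  | Mu k f => fun v y =>
      computes f [tuple of y :: v] 0 /\
      forall x, x < y -> exists z, computes f [tuple of x :: v] z.+1
  end.

(* A problem [P] with inputs of type [I], encoded as numbers by [code], is
   decidable if a partial recursive function maps the code of every input to 1
   or 0 according as [P] holds or not. *)
Definition decidable_problem (I : Type) (code : I -> nat) (P : I -> Prop) : Prop :=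
  exists f : recfun 1, forall x : I,
    exists b : bool, computes f [tuple code x] b /\ (b <-> P x).

Definition letter_code (n : nat) (l : letter n) : nat :=
  if l is (t, Pos) then t.*2 else l.1.*2.+1.

Definition word_code (n : nat) (w : word n) : nat :=
  CodeSeq.code [seq letter_code l | l <- w].

(* Main.v *)
From HB Require Import structures.
From Stdlib Require Import Relation_Operators.
Require Import Defs.
From mathcomp Require Import all_boot all_order all_algebra.
From mathcomp Require Import generic_quotient boolp zify.

Set Implicit Arguments.
Unset Strict Implicit.
Unset Printing Implicit Defensive.

(** The words read off compact patterns form finitely many finite sets and
    finitely many families u v^k z, and equality of braids with a member of such
    a family is decidable.

    Patterns.  Forget the strand numbers of a generation and the empty cells at
    both ends: what is left is its state.  Strand numbers can be recovered by
    counting, and compactness bounds the size of states, so there are finitely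
    many of them.  Continuity, a turning rule and a crossing rule determine each
    state from the previous one ([trim_next]); hence the compact patterns obeying
    given rules and starting in a given state are initial segments of one orbit of
    a map on states.  Either their lengths are bounded, or the orbit stays in
    the finite set of states and is eventually periodic ([traject_periodic]),
    and then, apart from finitely many, the words are the u v^k z with u and v
    fixed and z in a finite set
    ([stage_eventually_periodic]).  As [n] is fixed, a recursive function may
    have these finitely many words built in.

    Word problem.  The braids with m generators that fix the last strand form a
    subgroup of index m+1, which is a semidirect product of the braids with m-1
    generators and the free group on the loops of the last strand around the other ones.
    Writing a braid as b f c, with c a coset representative, and going on with
    b, one obtains its combed form, a list of positions and reduced free words
    ([combed]).  It is invariant under the braid relations
    ([combed_relator]), which is a finite verification for each relation, and it
    determines the braid ([combed_sound]), as the word can be rewritten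
    step by step into b f c in any group satisfying the braid relations.

    Exponents.  It remains to bound the k with u v^k z = w, that is to bound k
    in terms of the length of x when v^k = x ([power_growth]).  Up to replacing
    v by a power, v fixes the last strand, v = b f.  If b has infinite order,
    then b^k is the corresponding part of x, which is not longer than x, and
    induction applies.  Otherwise a power of v lies in the free group, in which
    the powers of an element other than 1 have linearly growing length
    ([free_power_growth]), whereas the free part of x has at most exponential
    length.  So k runs over a finite range computable from w.

    Recursiveness.  Combed forms are computed by folds over lists of
    numbers.  Recursive functions are closed under these once pairs are encoded as
    numbers ([computable_foldl]). *)

(** * Recursive functions of numbers *)

Definition recursive (k : nat) (F : k.-tuple nat -> nat) : Prop :=
  exists f : recfun k, forall v, computes f v (F v).

Lemma recursive_ext k (F G : k.-tuple nat -> nat) :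
  F =1 G -> recursive F -> recursive G.
Proof. by move=> FG [f Hf]; exists f => v; rewrite -FG. Qed.

Lemma recursive_comp k m (F : m.-tuple nat -> nat)
    (G : 'I_m -> k.-tuple nat -> nat) :
  recursive F -> (forall i, recursive (G i)) ->
  recursive (fun v => F [tuple G i v | i < m]).
Proof.
move=> [f Hf] HG.
have /fin_all_exists [gs Hgs] : forall i, exists g, forall v, computes g v (G i v) by [].
exists (Comp f gs) => v; exists [tuple G i v | i < m]; last exact: Hf.
by move=> i; rewrite tnth_mktuple; apply: Hgs.
Qed.

Lemma recursive_prec k (B : k.-tuple nat -> nat) (S : k.+2.-tuple nat -> nat) :
  recursive B -> recursive S ->
  recursive (fun v : k.+1.-tuple nat =>
    nat_rect (fun _ => nat) (B [tuple of behead v])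
      (fun i a => S [tuple of i :: a :: behead v]) (thead v)).
Proof.
move=> [b Hb] [s Hs]; exists (Prec b s) => v /=.
exists (nat_rect (fun _ => nat) (B [tuple of behead v])
      (fun i a => S [tuple of i :: a :: behead v])); split=> //.
Qed.

(** Unlike the other constructors, minimization yields a partial function, so
    the conclusion is restricted to the arguments at which [m] gives the first
    zero. *)
Lemma recursive_mu k (F : k.+1.-tuple nat -> nat) (m : k.-tuple nat -> nat) :
  recursive F ->
  exists f : recfun k, forall v,
    F [tuple of m v :: v] = 0 -> (forall x, x < m v -> 0 < F [tuple of x :: v]) ->
    computes f v (m v).
Proof.
move=> [f Hf]; exists (Mu f) => v F0 Fpos; split; first by rewrite -F0; apply: Hf.
by move=> x /Fpos xm; exists (F [tuple of x :: v]).-1; rewrite prednK.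
Qed.

Definition rec1 (f : nat -> nat) := recursive (fun v : 1.-tuple nat => f (tnth v ord0)).
Definition rec2 (f : nat -> nat -> nat) :=
  recursive (fun v : 2.-tuple nat => f (tnth v ord0) (tnth v ord_max)).

Lemma recursive_proj k (i : 'I_k) : recursive (fun v => tnth v i).
Proof. by exists (Proj i). Qed.

Lemma recursive_app1 k f (F : k.-tuple nat -> nat) :
  rec1 f -> recursive F -> recursive (fun v => f (F v)).
Proof.
move=> Hf HF; apply: recursive_ext (recursive_comp (G := fun=> F) Hf (fun=> HF)) => v.
by rewrite tnth_mktuple.
Qed.

Lemma recursive_app2 k f (F G : k.-tuple nat -> nat) :
  rec2 f -> recursive F -> recursive G -> recursive (fun v => f (F v) (G v)).
Proof.
move=> Hf HF HG.
have HH (i : 'I_2) : recursive (if i == ord0 then F else G) by case: ifP.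
by apply: recursive_ext (recursive_comp Hf HH) => v; rewrite !tnth_mktuple.
Qed.

Lemma recursive_zero k : recursive (fun _ : k.-tuple nat => 0).
Proof. by exists (Zero k). Qed.

Lemma rec1_succ : rec1 succn.
Proof. by exists Succ => v. Qed.

Lemma recursive_const k c : recursive (fun _ : k.-tuple nat => c).
Proof.
by elim: c => [|c IH]; [apply: recursive_zero | apply: recursive_app1 rec1_succ IH].
Qed.

Lemma rec2_nat_rect b s : rec1 b -> 
  recursive (fun v : 3.-tuple nat =>
    s (tnth v ord0) (tnth v (lift ord0 ord0)) (tnth v ord_max)) ->
  rec2 (fun n x => nat_rect (fun _ => nat) (b x) (fun i a => s i a x) n).
Proof.
move=> Hb Hs; apply: recursive_ext (recursive_prec Hb Hs) => v /=.
by case/tupleP: v => n v; case/tupleP: v => x v.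
Qed.

Lemma rec1_nat_rect c s : rec2 s ->
  rec1 (nat_rect (fun _ => nat) c s).
Proof.
move=> Hs; have Hb := recursive_const 0 c.
apply: recursive_ext (recursive_prec Hb Hs) => v.
by case/tupleP: v => n v; rewrite theadE; elim: n => //= i ->.
Qed.

Lemma rec2_iter f : rec1 f -> rec2 (fun n x => iter n f x).
Proof.
move=> Hf.
have H := rec2_nat_rect (b := id) (s := fun _ a _ => f a) (recursive_proj _)
  (recursive_app1 Hf (recursive_proj _)).
by apply: recursive_ext H => v /=; elim: (tnth v ord0) => //= i ->.
Qed.

Lemma rec2_addn : rec2 addn.
Proof.
by apply: recursive_ext (rec2_iter rec1_succ) => v; rewrite iter_succn addnC.
Qed.

Lemma rec1_pred : rec1 predn.
Proof.
apply: recursive_ext (rec1_nat_rect 0 (s := fun i _ => i) (recursive_proj _)) => v.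
by case: (tnth v ord0).
Qed.

Lemma rec2_flip f : rec2 f -> rec2 (fun x y => f y x).
Proof. by move=> Hf; apply: recursive_app2 Hf _ _; apply: recursive_proj. Qed.

Lemma rec2_subn : rec2 subn.
Proof.
by apply: recursive_ext (rec2_flip (rec2_iter rec1_pred)) => v; rewrite iter_predn.
Qed.

Lemma rec1_odd : rec1 odd.
Proof.
have H : rec2 (fun _ a => 1 - a).
  by apply: recursive_app2 rec2_subn _ _; [apply: recursive_const | apply: recursive_proj].
apply: recursive_ext (rec1_nat_rect 0 H) => v.
by elim: (tnth v ord0) => //= i ->; case: odd.
Qed.

Lemma rec1_half : rec1 half.
Proof.
apply: recursive_ext (rec1_nat_rect 0 rec2_subn) => v.
elim: (tnth v ord0) => //= i ->.
by rewrite uphalf_half -[in X in X - _](odd_double_half i) -addnn addnA addnK.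
Qed.

(** The code of [a :: s] in [CodeSeq.code] is [pair_code a (CodeSeq.code s)]: with
    this pairing, nonempty lists have the codes of pairs. *)
Definition pair_code x y := 2 ^ x * y.*2.+1.

Lemma pair_codeE x y : pair_code x y = iter x double y.*2.+1.
Proof.
by rewrite /pair_code; elim: x => [|x IH] /=; rewrite ?mul1n // expnS -mulnA IH mul2n.
Qed.

Lemma rec1_double : rec1 double.
Proof.
apply: (@recursive_ext _ (fun v : 1.-tuple nat => tnth v ord0 + tnth v ord0)) => [v|].
  exact: addnn.
by apply: recursive_app2 rec2_addn _ _; apply: recursive_proj.
Qed.

Lemma rec2_pair_code : rec2 pair_code.
Proof.
apply: (@recursive_ext _ (fun v : 2.-tuple nat =>
   iter (tnth v ord0) double (tnth v ord_max).*2.+1)) => [v|].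
  by rewrite pair_codeE.
apply: recursive_app2 (rec2_iter rec1_double) (recursive_proj _) _.
apply: recursive_app1 rec1_succ _.
exact: recursive_app1 rec1_double (recursive_proj _).
Qed.

Definition unpair1 z := logn 2 z.
Definition unpair2 z := (iter (logn 2 z) half z)./2.

Lemma iter_half_pair_code i x y :
  i <= x -> iter i half (pair_code x y) = pair_code (x - i) y.
Proof.
elim: i => [|i IH] ix; first by rewrite subn0.
rewrite iterS IH ?(ltnW ix) // subnS !pair_codeE.
by move: ix; rewrite -subn_gt0; case: (x - i) => //= d _; rewrite doubleK.
Qed.

Lemma unpair1K x y : unpair1 (pair_code x y) = x.
Proof.
rewrite /unpair1 lognM ?expn_gt0 // pfactorK // lognE /= dvdn2 /= odd_double /=.
by rewrite addn0.
Qed.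

Lemma unpair2K x y : unpair2 (pair_code x y) = y.
Proof.
rewrite /unpair2 -/(unpair1 _) unpair1K iter_half_pair_code // subnn pair_codeE /=.
by rewrite uphalf_double.
Qed.

Lemma pair_code_inj x y x' y' :
  pair_code x y = pair_code x' y' -> (x, y) = (x', y').
Proof.
move=> E; have := unpair1K x y; have := unpair2K x y.
by rewrite E unpair1K unpair2K => -> ->.
Qed.

(** [x] is the number of halvings that lead from the code to an odd number.
    Minimization is undefined at 0, which is not the code of a pair. *)
Lemma unpair1_computes : exists f : recfun 1, forall x y,
  computes f [tuple pair_code x y] x.
Proof.
have H : rec2 (fun i z => 1 - odd (iter i half z)).
  apply: recursive_app2 rec2_subn (recursive_const _ _) _.
  exact: recursive_app1 rec1_odd (rec2_iter rec1_half).
have [f Hf] := recursive_mu (fun v => unpair1 (thead v)) H.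
exists f => x y; have := Hf [tuple pair_code x y].
rewrite theadE unpair1K; apply.
  by rewrite /= !(tnth_nth 0) /= iter_half_pair_code // subnn pair_codeE /= odd_double.
move=> i ix; rewrite /= !(tnth_nth 0) /= iter_half_pair_code; last exact: ltnW.
by move: ix; rewrite pair_codeE -subn_gt0; case: (x - i) => //= d _; rewrite odd_double.
Qed.

Lemma unpair2_computes : exists f : recfun 1, forall x y,
  computes f [tuple pair_code x y] y.
Proof.
have [f Hf] := unpair1_computes.
have [g Hg] : rec2 (fun i z => (iter i half z)./2).
  exact: recursive_app1 rec1_half (rec2_iter rec1_half).
exists (Comp g (fun i : 'I_2 => if i == ord0 then f else Proj ord0)) => x y /=.
exists [tuple x; pair_code x y].
  move=> j; case: (unliftP ord0 j) => [i|] -> /=; last exact: Hf.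
  by rewrite ord1.
have := Hg [tuple x; pair_code x y].
rewrite !(tnth_nth 0) /= iter_half_pair_code // subnn [pair_code 0 y]pair_codeE /=.
by rewrite uphalf_double.
Qed.

(** * Computable functions on encoded data *)

(** Injectivity lets equality of data be tested on their codes. *)
Class Encoding (T : Type) := { enc : T -> nat; enc_inj : injective enc }.

Instance Encoding_nat : Encoding nat := { enc := id; enc_inj := @inj_id nat }.

Lemma nat_of_bool_inj : injective nat_of_bool.
Proof. by move=> [] []. Qed.

Instance Encoding_bool : Encoding bool :=
  { enc := nat_of_bool; enc_inj := nat_of_bool_inj }.

Section Encodings.
Context {A B : Type} {eA : Encoding A} {eB : Encoding B}.

Lemma enc_pair_inj : injective (fun p : A * B => pair_code (enc p.1) (enc p.2)).
Proof.
move=> [a b] [a' b'] /pair_code_inj /= [ea eb].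
by rewrite (enc_inj ea) (enc_inj eb).
Qed.

Global Instance Encoding_prod : Encoding (A * B) := { enc_inj := enc_pair_inj }.

Definition enc_seq (s : seq A) : nat := CodeSeq.code (map enc s).

Lemma enc_seq_inj : injective enc_seq.
Proof. by move=> s t /(can_inj CodeSeq.codeK); apply: inj_map enc_inj _ _. Qed.

Global Instance Encoding_seq : Encoding (seq A) := { enc_inj := enc_seq_inj }.
End Encodings.

Lemma enc_cons {A} {eA : Encoding A} (a : A) s : enc (a :: s) = enc (a, s).
Proof. by []. Qed.

Definition computable {A B} {eA : Encoding A} {eB : Encoding B} (f : A -> B) :=
  exists r : recfun 1, forall a, computes r [tuple enc a] (enc (f a)).

Section Computable.
Context {A B C D : Type} {eA : Encoding A} {eB : Encoding B}.
Context {eC : Encoding C} {eD : Encoding D}.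

Lemma computable_ext (f g : A -> B) : f =1 g -> computable f -> computable g.
Proof. by move=> fg [r Hr]; exists r => a; rewrite -fg. Qed.

Lemma computable_id : computable (fun a : A => a).
Proof. by exists (Proj ord0) => a. Qed.

Lemma computable_comp (g : B -> C) (f : A -> B) :
  computable g -> computable f -> computable (fun a => g (f a)).
Proof.
move=> [s Hs] [r Hr]; exists (Comp s (fun=> r)) => a /=.
by exists [tuple enc (f a)] => // i; rewrite ord1; apply: Hr.
Qed.

Lemma computable_const (b : B) : computable (fun _ : A => b).
Proof. by have [r Hr] := recursive_const 1 (enc b); exists r => a; apply: Hr. Qed.

Lemma computable_rec2 h (f : A -> B) (g : A -> C) (k : A -> D) : rec2 h ->
  (forall a, enc (k a) = h (enc (f a)) (enc (g a))) ->
  computable f -> computable g -> computable k.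
Proof.
move=> [t Ht] E [r Hr] [s Hs].
exists (Comp t (fun i : 'I_2 => if i == ord0 then r else s)) => a /=.
exists [tuple enc (f a); enc (g a)].
  move=> j; case: (unliftP ord0 j) => [i|] -> /=; last exact: Hr.
  by rewrite ord1 !(tnth_nth 0) /=; apply: Hs.
by rewrite E; have := Ht [tuple enc (f a); enc (g a)].
Qed.

Lemma computable_rec1 h (f : A -> B) (k : A -> C) : rec1 h ->
  (forall a, enc (k a) = h (enc (f a))) -> computable f -> computable k.
Proof.
move=> [t Ht] E [r Hr]; exists (Comp t (fun=> r)) => a /=.
exists [tuple enc (f a)]; first by move=> i; rewrite ord1; apply: Hr.
by rewrite E; apply: Ht.
Qed.

End Computable.

Section ComputablePairs.
Context {A B C: Type} {eA : Encoding A} {eB : Encoding B} {eC : Encoding C}.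

Lemma computable_pair (f : A -> B) (g : A -> C) :
  computable f -> computable g -> computable (fun a => (f a, g a)).
Proof. by move=> Hf Hg; apply: computable_rec2 rec2_pair_code _ Hf Hg. Qed.

Lemma computable_cons (f : A -> B) (g : A -> seq B) :
  computable f -> computable g -> computable (fun a => f a :: g a).
Proof. exact: computable_rec2 rec2_pair_code _. Qed.

Lemma computable_fst (f : A -> B * C) : computable f -> computable (fun a => (f a).1).
Proof.
apply: computable_comp; have [r Hr] := unpair1_computes.
by exists r => a; apply: Hr.
Qed.

Lemma computable_snd (f : A -> B * C) : computable f -> computable (fun a => (f a).2).
Proof.
apply: computable_comp; have [r Hr] := unpair2_computes.
by exists r => a; apply: Hr.
Qed.

Lemma computable_if (b : A -> bool) (f g : A -> B) :
  computable b -> computable f -> computable g ->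
  computable (fun a => if b a then f a else g a).
Proof.
move=> [r Hr] [s Hs] [t Ht].
pose s' := Comp s (fun _ : 'I_1 => Proj (ord_max : 'I_3)).
exists (Comp (Prec t s') (fun i : 'I_2 => if i == ord0 then r else Proj ord0)) => a /=.
exists [tuple enc (b a); enc a].
  move=> j; case: (unliftP ord0 j) => [i|] -> /=; last exact: Hr.
  by rewrite ord1 !(tnth_nth 0).
exists (fun i => if i is 0 then enc (g a) else enc (f a)); split.
- by have := Ht a; congr (computes t _ _); apply: val_inj.
- move=> i _; exists [tuple enc a]; first by move=> j; rewrite ord1 !(tnth_nth 0).
  exact: Hs.
- by rewrite theadE; case: (b a).
Qed.

End ComputablePairs.

Lemma enc_cons_gt0 {A} {eA : Encoding A} (a : A) s : 0 < enc (a :: s).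
Proof. by rewrite muln_gt0 expn_gt0. Qed.

(** The branch [g] is only evaluated for nonempty [s a], as it may be undefined
    on other codes: a primitive recursion on the code of [s a] calls it in its
    step alone. *)
Lemma computable_match_seq {A B C : Type} {eA : Encoding A} {eB : Encoding B}
    {eC : Encoding C} (s : A -> seq B) (f : A -> C) (g : A -> B -> seq B -> C) :
  computable s -> computable f ->
  computable (fun x : A * (B * seq B) => g x.1 x.2.1 x.2.2) ->
  computable (fun a => if s a is b :: t then g a b t else f a).
Proof.
move=> [rs Hs] [rf Hf] [rg Hg]; have [rp Hp] := rec2_pair_code.
pose base := Comp rf (fun _ : 'I_1 => Proj (ord0 : 'I_2)).
pose step := Comp rg (fun _ : 'I_1 => Comp rp (fun i : 'I_2 =>
   Proj (if i == ord0 then inord 2 else inord 3 : 'I_4))).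
exists (Comp (Prec base step) (fun i : 'I_3 =>
   if i == inord 1 then Proj ord0 else rs)) => a /=.
exists [tuple enc (s a); enc a; enc (s a)].
  move=> [[|[|[|//]]] Hi]; rewrite -val_eqE /= inordK //= !(tnth_nth 0) //=.
(* The recursion runs [enc (s a)] times, but its value is final after one step. *)
exists (fun i => if i is 0 then enc (f a) else
  enc (if s a is b :: t then g a b t else f a)); split.
- exists [tuple enc a]; last exact: Hf.
  by move=> i; rewrite ord1 !(tnth_nth 0).
- rewrite theadE => i; case E: (s a) => [|b t] // _.
  exists [tuple enc (a, (b, t))]; last exact: Hg.
  move=> j; rewrite ord1; exists [tuple enc a; enc (b :: t)].
    by move=> [[|[|//]] Hk]; rewrite -val_eqE /= !(tnth_nth 0) /= inordK.
  by have := Hp [tuple enc a; enc (b :: t)].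
- rewrite theadE; case: (s a) => // b t.
  by have := @enc_cons_gt0 _ eB b t; case: (enc (b :: t)).
Qed.

Lemma computable_iter {A S : Type} {eA : Encoding A} {eS : Encoding S}
    (n : A -> nat) (g : A -> S -> S) (z : A -> S) :
  computable n -> computable z -> computable (fun x : A * S => g x.1 x.2) ->
  computable (fun a => iter (n a) (g a) (z a)).
Proof.
move=> [rn Hn] [rz Hz] [rg Hg]; have [rp Hp] := rec2_pair_code.
pose step := Comp rg (fun _ : 'I_1 => Comp rp (fun i : 'I_2 =>
   Proj (if i == ord0 then inord 2 else inord 1 : 'I_3))).
exists (Comp (Prec rz step) (fun i : 'I_2 =>
   if i == ord0 then rn else Proj ord0)) => a /=.
exists [tuple enc (n a); enc a].
  by move=> [[|[|//]] Hi]; rewrite -val_eqE /= !(tnth_nth 0) //=.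
exists (fun i => enc (iter i (g a) (z a))); split.
- by have := Hz a; congr (computes rz _ _); apply: val_inj.
- move=> i _; exists [tuple enc (a, iter i (g a) (z a))]; last exact: (Hg (a, _)).
  move=> j; rewrite ord1; exists [tuple enc a; enc (iter i (g a) (z a))].
    by move=> [[|[|//]] Hk]; rewrite -val_eqE /= !(tnth_nth 0) /= inordK.
  by have := Hp [tuple enc a; enc (iter i (g a) (z a))].
- by rewrite theadE.
Qed.

Lemma size_enc {A} {eA : Encoding A} (s : seq A) : size s <= enc s.
Proof.
elim: s => [//|a s IH]; rewrite enc_cons [size _]/= [enc (a, s)]/= /pair_code.
apply: leq_trans (leq_pmull _ _); last by rewrite expn_gt0.
by rewrite ltnS (leq_trans IH) // -addnn leq_addr.
Qed.

(** The matching is syntactic because unification modulo conversion may unfold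
    [computable] and diverge. *)
Ltac computability := repeat match goal with
  | H : computable ?f |- computable ?f => exact H
  | |- computable (fun x => x) => exact: computable_id
  | |- computable (fun _ => ?c) => exact: computable_const
  | |- computable fst => refine (computable_fst (f := fun x => x) _)
  | |- computable snd => refine (computable_snd (f := fun x => x) _)
  | |- computable (fun x => (@?f x, @?g x)) =>
      refine (computable_pair (f := f) (g := g) _ _)
  | |- computable (fun x => @?f x :: @?g x) =>
      refine (computable_cons (f := f) (g := g) _ _)
  | |- computable (fun x => (@?f x).1) => refine (computable_fst (f := f) _)
  | |- computable (fun x => (@?f x).2) => refine (computable_snd (f := f) _)
  end.

(** The list is consumed one item at a time; the code of a list bounds its size,
    and the surplus iterations do nothing. *)
Lemma computable_foldl {A B S : Type} {eA : Encoding A} {eB : Encoding B}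
    {eS : Encoding S} (g : A -> S -> B -> S) (z : A -> S) (s : A -> seq B) :
  computable (fun x : A * (S * B) => g x.1 x.2.1 x.2.2) ->
  computable z -> computable s ->
  computable (fun a => foldl (g a) (z a) (s a)).
Proof.
move=> Hg Hz Hs.
pose step a (x : S * seq B) : S * seq B :=
  if x.2 is b :: t then (g a x.1 b, t) else x.
have Hstep : computable (fun x : A * (S * seq B) => step x.1 x.2).
  apply: (computable_match_seq (s := fun x => x.2.2)
    (g := fun x b t => (g x.1 x.2.1 b, t))).
  - by computability.
  - by computability.
  apply: computable_pair; last by computability.
  apply: (computable_comp (f := fun x : (A * (S * seq B)) * (B * seq B) =>
     (x.1.1, (x.1.2.1, x.2.1))) Hg).
  by computability.
have Hn : computable (fun a => enc (s a)) by have [r Hr] := Hs; exists r.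
have Hzs : computable (fun a => (z a, s a)) by apply: computable_pair.
apply: computable_ext (computable_fst (computable_iter Hn Hzs Hstep)) => a /=.
have {Hn Hzs} -> : forall n z t, size t <= n ->
    iter n (step a) (z, t) = (foldl (g a) z t, [::]) => //; last exact: size_enc.
elim=> [|n IH] x [|b t] //.
  by move=> _; rewrite iterS IH.
by move=> lt_n; rewrite iterSr; apply: IH.
Qed.

Lemma computable_rev {A B : Type} {eA : Encoding A} {eB : Encoding B}
    (s : A -> seq B) : computable s -> computable (fun a => rev (s a)).
Proof.
move=> Hs.
have H : computable (fun x : A * (seq B * B) => x.2.2 :: x.2.1) by computability.
apply: computable_ext
  (computable_foldl (g := fun _ l b => b :: l) H (computable_const [::]) Hs).
by move=> a; rewrite /rev; elim: (s a) [::] => //= b t IH l; rewrite IH.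
Qed.

Section ComputableSeq.
Context {A B C : Type} {eA : Encoding A} {eB : Encoding B} {eC : Encoding C}.

Lemma computable_foldr (g : A -> B -> C -> C) (z : A -> C) (s : A -> seq B) :
  computable (fun x : A * (B * C) => g x.1 x.2.1 x.2.2) ->
  computable z -> computable s ->
  computable (fun a => foldr (g a) (z a) (s a)).
Proof.
move=> Hg Hz Hs.
have H : computable (fun x : A * (C * B) => g x.1 x.2.2 x.2.1).
  apply: (computable_comp (f := fun x : A * (C * B) => (x.1, (x.2.2, x.2.1))) Hg).
  by computability.
apply: computable_ext (computable_foldl (g := fun a c b => g a b c) H Hz (computable_rev Hs)).
by move=> a; rewrite foldl_rev.
Qed.
End ComputableSeq.

Lemma computable_cat {A : Type} {eA : Encoding A} {B : Type} {eB : Encoding B}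
    (s t : A -> seq B) :
  computable s -> computable t -> computable (fun a => s a ++ t a).
Proof.
move=> Hs Ht; have H : computable (fun x : A * (B * seq B) => x.2.1 :: x.2.2).
  by computability.
apply: computable_ext (computable_foldr (g := fun _ => cons) H Ht Hs) => a.
by elim: (s a) => //= b l ->.
Qed.

Lemma computable_map {A : Type} {eA : Encoding A}
    {B C : Type} {eB : Encoding B} {eC : Encoding C}
    (f : A -> B -> C) (s : A -> seq B) :
  computable (fun x : A * B => f x.1 x.2) -> computable s ->
  computable (fun a => [seq f a b | b <- s a]).
Proof.
move=> Hf Hs.
have H : computable (fun x : A * (B * seq C) => f x.1 x.2.1 :: x.2.2).
  apply: computable_cons; last by computability.
  apply: (computable_comp (f := fun x : A * (B * seq C) => (x.1, x.2.1)) Hf).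
  by computability.
apply: computable_ext
  (computable_foldr (g := fun a b l => f a b :: l) H (computable_const [::]) Hs).
by move=> a; elim: (s a) => //= b l ->.
Qed.

Lemma computable_flatten {A : Type} {eA : Encoding A} {B : Type}
    {eB : Encoding B}
    (s : A -> seq (seq B)) :
  computable s -> computable (fun a => flatten (s a)).
Proof.
move=> Hs; have H : computable (fun x : A * (seq B * seq B) => x.2.1 ++ x.2.2).
  by apply: computable_cat; computability.
exact: (computable_foldr (g := fun _ => cat) H (computable_const [::]) Hs).
Qed.

Lemma computable_has {A : Type} {eA : Encoding A} {B : Type} {eB : Encoding B}
    (p : A -> B -> bool) (s : A -> seq B) :
  computable (fun x : A * B => p x.1 x.2) -> computable s ->
  computable (fun a => has (p a) (s a)).
Proof.
move=> Hp Hs.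
have H : computable (fun x : A * (B * bool) => if p x.1 x.2.1 then true else x.2.2).
  apply: computable_if; [|by computability..].
  apply: (computable_comp (f := fun x : A * (B * bool) => (x.1, x.2.1)) Hp).
  by computability.
apply: computable_ext (computable_foldr (g := fun a b r => if p a b then true else r)
  H (computable_const false) Hs).
by move=> a; elim: (s a) => //= b l ->; case: p.
Qed.

Lemma computable_succn {A : Type} {eA : Encoding A}
    (n : A -> nat) :
  computable n -> computable (fun a => (n a).+1).
Proof. exact: computable_rec1 rec1_succ _. Qed.

Lemma computable_predn {A : Type} {eA : Encoding A}
    (n : A -> nat) :
  computable n -> computable (fun a => (n a).-1).
Proof. exact: computable_rec1 rec1_pred _. Qed.

Lemma computable_half {A : Type} {eA : Encoding A}
    (n : A -> nat) :
  computable n -> computable (fun a => (n a)./2).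
Proof. exact: computable_rec1 rec1_half _. Qed.

Lemma computable_odd {A : Type} {eA : Encoding A}
    (n : A -> nat) :
  computable n -> computable (fun a => odd (n a)).
Proof. exact: computable_rec1 rec1_odd _. Qed.

Lemma computable_addn {A : Type} {eA : Encoding A} (m n : A -> nat) :
  computable m -> computable n -> computable (fun a => m a + n a).
Proof. exact: computable_rec2 rec2_addn _. Qed.

Lemma computable_leq {A : Type} {eA : Encoding A} (m n : A -> nat) :
  computable m -> computable n -> computable (fun a => m a <= n a).
Proof.
have H : rec2 (fun x y => 1 - (x - y)).
  exact: recursive_app2 rec2_subn (recursive_const _ _) rec2_subn.
apply: computable_rec2 H _ => a; rewrite /= /leq.
by case: (m a - n a) => // k; rewrite subSS sub0n.
Qed.

Lemma computable_andb {A : Type} {eA : Encoding A} (p q : A -> bool) :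
  computable p -> computable q -> computable (fun a => p a && q a).
Proof. by move=> Hp Hq; apply: computable_if; computability. Qed.

Lemma computable_negb {A : Type} {eA : Encoding A}
    (p : A -> bool) :
  computable p -> computable (fun a => ~~ p a).
Proof. by move=> Hp; apply: computable_if; computability. Qed.

Lemma computable_orb {A : Type} {eA : Encoding A} (p q : A -> bool) :
  computable p -> computable q -> computable (fun a => p a || q a).
Proof. by move=> Hp Hq; apply: computable_if; computability. Qed.

Lemma computable_eq {A : Type} {eA : Encoding A} {B : eqType} {eB : Encoding B}
    (f g : A -> B) :
  computable f -> computable g -> computable (fun a => f a == g a).
Proof.
have Hn : computable (fun b : B => enc b) by exists (Proj ord0).
move=> Hf Hg.
have Hef := computable_comp Hn Hf; have Heg := computable_comp Hn Hg.
have H := computable_andb (computable_leq Hef Heg) (computable_leq Heg Hef).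
apply: computable_ext H => a; rewrite -eqn_leq.
by apply/eqP/eqP => [|-> //]; apply: enc_inj.
Qed.

Lemma computable_size {A : Type} {eA : Encoding A} {B : Type} {eB : Encoding B}
    (s : A -> seq B) :
  computable s -> computable (fun a => size (s a)).
Proof.
move=> Hs; have H : computable (fun x : A * (B * nat) => x.2.2.+1).
  by apply: computable_succn; computability.
apply: computable_ext (computable_foldr (g := fun _ _ => succn) H (computable_const 0) Hs).
by move=> a; elim: (s a) => //= b l ->.
Qed.

Lemma computable_iota {A : Type} {eA : Encoding A}
    (n : A -> nat) :
  computable n -> computable (fun a => iota 0 (n a)).
Proof.
move=> Hn.
have H : computable (fun x : A * seq nat => rev (size x.2 :: rev x.2)).
  refine (computable_rev _); apply: computable_cons.
    by refine (computable_size _); computability.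
  by refine (computable_rev _); computability.
apply: computable_ext (computable_iter (g := fun _ l => rev (size l :: rev l)) Hn
  (computable_const [::]) H).
move=> a; elim: (n a) => // k IH; rewrite iterS IH rev_cons revK size_iota.
by rewrite -addn1 iotaD cats1.
Qed.

Lemma computable_expn {A : Type} {eA : Encoding A}
    c (n : A -> nat) :
  computable n -> computable (fun a => c ^ n a).
Proof.
move=> Hn.
have H : computable (fun x : A * nat => iter c (addn x.2) 0).
  apply: (computable_iter (g := fun x : A * nat => addn x.2)); try exact: computable_const.
  by apply: computable_addn; computability.
apply: computable_ext (computable_iter (g := fun _ x => iter c (addn x) 0) Hn
  (computable_const 1) H).
by move=> a; elim: (n a) => // k IH; rewrite iterS IH iter_addn_0 expnS mulnC.
Qed.

(** * Words and their values in groups *)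

Local Open Scope quotient_scope.
Local Open Scope group_scope.

(** [(i, true)] is the generator of index [i] and [(i, false)] its inverse.  Indices
    are unbounded, so that one type serves all braid groups and free groups. *)
Definition gen := (nat * bool)%type.
Definition inv_gen (a : gen) : gen := (a.1, ~~ a.2).

Lemma inv_genK : involutive inv_gen.
Proof. by case=> i e; rewrite /inv_gen /= negbK. Qed.

Section Eval.
Variables (G : groupType) (x : nat -> G).

Definition eval_gen (a : gen) : G := if a.2 then x a.1 else (x a.1)^-1.
Definition eval (w : seq gen) : G := foldr (fun a z => eval_gen a * z) 1 w.

Lemma eval_cat u v : eval (u ++ v) = eval u * eval v.
Proof. by elim: u => [|a u IH] /=; rewrite ?mul1g // IH mulgA. Qed.

Lemma eval_rcons u a : eval (rcons u a) = eval u * eval_gen a.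
Proof. by rewrite -cats1 eval_cat /= mulg1. Qed.

Lemma eval_inv_gen a : eval_gen (inv_gen a) = (eval_gen a)^-1.
Proof. by case: a => i [] //=; rewrite /eval_gen /= invgK. Qed.
End Eval.

(** The relations whose classes of words form a group. *)
Record word_congruence (R : seq gen -> seq gen -> Prop) : Prop := WordCongruence {
  wc_refl : forall u, R u u;
  wc_sym : forall u v, R u v -> R v u;
  wc_trans : forall u v w, R u v -> R v w -> R u w;
  wc_cat : forall u u' v v', R u u' -> R v v' -> R (u ++ v) (u' ++ v');
  wc_inv : forall a, R [:: a; inv_gen a] [::] }.

Section Quotient.
Variables (R : seq gen -> seq gen -> Prop) (HR : word_congruence R).

Local Definition quot_rel u v := `[< R u v >].

Local Lemma quot_rel_refl : reflexive quot_rel.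
Proof. by move=> u; apply/asboolP/(wc_refl HR). Qed.
Local Lemma quot_rel_sym : symmetric quot_rel.
Proof. by move=> u v; apply/asboolP/asboolP; apply: (wc_sym HR). Qed.
Local Lemma quot_rel_trans : transitive quot_rel.
Proof. by move=> v u w /asboolP uv /asboolP vw; apply/asboolP/(wc_trans HR uv vw). Qed.

Local Canonical quot_rel_equiv := EquivRel quot_rel quot_rel_refl quot_rel_sym quot_rel_trans.

Definition quot := {eq_quot quot_rel_equiv}.
HB.instance Definition _ := Choice.on quot.

Definition class_of (w : seq gen) : quot := (\pi_{eq_quot quot_rel_equiv} w)%qT.

Lemma class_ofP u v : class_of u = class_of v <-> R u v.
Proof.
split=> [/eqmodP /asboolP //|uv].
by apply/eqmodP/asboolP.
Qed.

Lemma class_of_repr (q : quot) : class_of (repr q) = q.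
Proof. exact: reprK. Qed.

Lemma repr_class_of w : R (repr (class_of w)) w.
Proof. by apply/class_ofP; rewrite class_of_repr. Qed.

Local Definition qmul (p q : quot) := class_of (repr p ++ repr q).
Local Definition qinv (p : quot) := class_of (rev (map inv_gen (repr p))).

Lemma class_of_cat u v : class_of (u ++ v) = qmul (class_of u) (class_of v).
Proof. by apply/class_ofP/(wc_cat HR); apply/(wc_sym HR)/repr_class_of. Qed.

Local Lemma wc_inv_word u : R (u ++ rev (map inv_gen u)) [::].
Proof.
elim: u => [|a u IH] /=; first exact: (wc_refl HR).
have -> : a :: u ++ rev (inv_gen a :: map inv_gen u) =
    [:: a] ++ (u ++ rev (map inv_gen u)) ++ [:: inv_gen a].
  by rewrite rev_cons -cats1 /= catA.
apply: (wc_trans HR _ (wc_inv HR a)).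
apply: (wc_cat HR (u := [:: a]) (u' := [:: a]) (v' := [::] ++ [:: inv_gen a])).
  exact: (wc_refl HR).
by apply: (wc_cat HR) => //; apply: (wc_refl HR).
Qed.

Local Lemma qmulA : associative qmul.
Proof.
move=> p q r; rewrite -(class_of_repr p) -(class_of_repr q) -(class_of_repr r).
by rewrite -!class_of_cat catA.
Qed.

Local Lemma qmul1 : left_id (class_of [::]) qmul.
Proof. by move=> p; rewrite -(class_of_repr p) -class_of_cat. Qed.

Local Lemma qmulr1 : right_id (class_of [::]) qmul.
Proof. by move=> p; rewrite -(class_of_repr p) -class_of_cat cats0. Qed.

Local Lemma qmulV : right_inverse (class_of [::]) qinv qmul.
Proof.
move=> p; rewrite -{1}(class_of_repr p) /qinv -class_of_cat.
exact/class_ofP/wc_inv_word.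
Qed.

Local Lemma qVmul : left_inverse (class_of [::]) qinv qmul.
Proof.
move=> p; rewrite -{2}(class_of_repr p) /qinv -class_of_cat.
apply/class_ofP; set u := repr p.
have {2}-> : u = rev (map inv_gen (rev (map inv_gen u))).
  by rewrite map_rev revK -map_comp (eq_map (inv_genK)) map_id.
exact: wc_inv_word.
Qed.

HB.instance Definition _ := isGroup.Build quot qmulA qmul1 qmulr1 qVmul qmulV.

(** Every group presented by generators and relations occurs among the groups in
    which words are evaluated; this turns identities valid in all groups into
    equivalences of words. *)
Lemma eval_class_of w : eval (fun i => class_of [:: (i, true)]) w = class_of w.
Proof.
elim: w => //= a w ->; rewrite -[a :: w]cat1s class_of_cat; congr (_ * _).
case: a => i [] //; rewrite /eval_gen /=; apply: mulg1_eq.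
by rewrite -[LHS]class_of_cat; apply/class_ofP/(wc_inv HR (i, true)).
Qed.

End Quotient.

(** * Free groups *)

Definition push (a : gen) (s : seq gen) : seq gen :=
  if s is b :: t then if b == inv_gen a then t else a :: s else [:: a].

Definition norm (w : seq gen) : seq gen := foldr push [::] w.

Definition reduced (s : seq gen) : bool := sorted (fun a b => b != inv_gen a) s.

Lemma push_reduced a s : reduced s -> reduced (push a s).
Proof.
case: s => [|b s] //=; case: ifP => [_ /path_sorted //|/negbT /= -> //].
Qed.

Lemma norm_reduced w : reduced (norm w).
Proof. by elim: w => //= a w; apply: push_reduced. Qed.

Lemma norm_id s : reduced s -> norm s = s.
Proof.
elim: s => //= a [|b s] IH //= /andP[ab bs]; rewrite -[push b _]/(norm (b :: s)) IH //=.
by rewrite (negbTE ab).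
Qed.

(** Reducedness excludes that the item uncovered by the inner cancellation
    cancels with [a] again. *)
Lemma pushK a s : reduced s -> push a (push (inv_gen a) s) = s.
Proof.
case: s => [|b s] /=; first by rewrite eqxx.
rewrite inv_genK; case: eqP => [->|_ _]; last by rewrite /= eqxx.
by case: s => //= c s /andP[/negbTE ->].
Qed.

(** A cancellation inside [u] becomes two consecutive pushes of inverse
    letters, which undo each other by [pushK]. *)
Lemma foldr_push_norm u s : reduced s -> foldr push s (norm u) = foldr push s u.
Proof.
move=> sR; elim: u => //= a u <-.
have: reduced (norm u) by apply: norm_reduced.
case: (norm u) => [|b t] //= _; case: eqP => [->|//] /=.
by rewrite pushK //; elim: t => //= c t; apply: push_reduced.
Qed.

Lemma norm_cat u v : norm (u ++ v) = foldr push (norm v) u.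
Proof. exact: foldr_cat. Qed.

Lemma norm_catr u v : norm (u ++ norm v) = norm (u ++ v).
Proof. by rewrite !norm_cat norm_id // norm_reduced. Qed.

Lemma norm_catl u v : norm (norm u ++ v) = norm (u ++ v).
Proof. by rewrite !norm_cat foldr_push_norm // norm_reduced. Qed.

Lemma norm_congruence : word_congruence (fun u v => norm u = norm v).
Proof.
split=> //; first by move=> u v w -> ->.
  by move=> u u' v v' uu' vv'; rewrite -norm_catr -norm_catl uu' vv' norm_catl norm_catr.
by move=> a; rewrite /= eqxx.
Qed.

Lemma eval_norm (G : groupType) (x : nat -> G) w : eval x (norm w) = eval x w.
Proof.
elim: w => //= a w <-; case: (norm w) => [|b t] //=; case: eqP => [->|//].
by rewrite eval_inv_gen mulVKg.
Qed.

(** Reduced words represent the free group, and its universal property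
    reduces identities between free words to computations in groups. *)
Lemma free_eqP u v :
  norm u = norm v <-> forall (G : groupType) (x : nat -> G), eval x u = eval x v.
Proof.
split=> [uv G x|E]; first by rewrite -eval_norm uv eval_norm.
by apply/(class_ofP norm_congruence); rewrite -!eval_class_of E.
Qed.

(** * Braid groups *)

(** The relations of the braid group with [m] generators.  Inverses cancel for all
    indices, not only those below [m], so that [braid_equiv m] makes words into a group. *)
Inductive relator (m : nat) : seq gen -> seq gen -> Prop :=
| relator_inv a : relator m [:: a; inv_gen a] [::]
| relator_far i k : i.+1 < k -> k < m ->
    relator m [:: (i, true); (k, true)] [:: (k, true); (i, true)]
| relator_braid i : i.+1 < m ->
    relator m [:: (i, true); (i.+1, true); (i, true)]
              [:: (i.+1, true); (i, true); (i.+1, true)].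

Inductive relator_step (m : nat) : seq gen -> seq gen -> Prop :=
| RelatorStep u v l r : relator m l r -> relator_step m (u ++ l ++ v) (u ++ r ++ v).

Definition braid_equiv (m : nat) : seq gen -> seq gen -> Prop :=
  clos_refl_sym_trans (seq gen) (@relator_step m).

Lemma braid_equiv_invariant m T (f : seq gen -> T) :
  (forall u v l r, relator m l r -> f (u ++ l ++ v) = f (u ++ r ++ v)) ->
  forall w w', braid_equiv m w w' -> f w = f w'.
Proof.
move=> H w w'; elim=> [_ _ [u v l r lr]|//|u v _ -> //|u v z _ -> _ -> //].
exact: H.
Qed.

Lemma relator_equiv m l r : relator m l r -> braid_equiv m l r.
Proof.
by move=> lr; apply: rst_step; rewrite -[l]cats0 -[r]cats0; apply: (RelatorStep [::] [::]).
Qed.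

Lemma braid_equiv_congruence m : word_congruence (braid_equiv m).
Proof.
have catl u v w : braid_equiv m v w -> braid_equiv m (u ++ v) (u ++ w).
  elim=> [_ _ [u' v' l r lr]|v'|v' w' _ IH|x y z _ IH _ IH']; last exact: rst_trans IH IH'.
  - by apply: rst_step; rewrite !(catA u); apply: RelatorStep.
  - exact: rst_refl.
  - exact: rst_sym.
have catr u v w : braid_equiv m v w -> braid_equiv m (v ++ u) (w ++ u).
  elim=> [_ _ [u' v' l r lr]|v'|v' w' _ IH|x y z _ IH _ IH']; last exact: rst_trans IH IH'.
  - by apply: rst_step; rewrite -!catA; apply: RelatorStep.
  - exact: rst_refl.
  - exact: rst_sym.
split.
- by move=> u; apply: rst_refl.
- by move=> u v; apply: rst_sym.
- by move=> u v w; apply: rst_trans.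
- by move=> u u' v v' uu' vv'; apply: rst_trans (catl _ _ _ vv'); apply: catr.
- by move=> a; apply/relator_equiv/relator_inv.
Qed.

Definition braid_relations (G : groupType) (s : nat -> G) (m : nat) : Prop :=
  (forall i k, i.+1 < k -> k < m -> s i * s k = s k * s i) /\
  (forall i, i.+1 < m -> s i * s i.+1 * s i = s i.+1 * s i * s i.+1).

Lemma braid_relations_le (G : groupType) (s : nat -> G) m p :
  p <= m -> braid_relations s m -> braid_relations s p.
Proof.
move=> pm [Hf Hb]; split=> [i k ik kp|i ip]; first by apply: Hf => //; apply: leq_trans pm.
by apply: Hb; apply: leq_trans pm.
Qed.

Lemma eval_relator (G : groupType) (s : nat -> G) m l r :
  braid_relations s m -> relator m l r -> eval s l = eval s r.
Proof.
case=> Hf Hb [a|i k ik km|i im] /=; rewrite ?mulg1.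
- by rewrite eval_inv_gen mulgV.
- exact: Hf.
- by rewrite !mulgA; apply: Hb.
Qed.

Lemma eval_braid_equiv (G : groupType) (s : nat -> G) m u v :
  braid_relations s m -> braid_equiv m u v -> eval s u = eval s v.
Proof.
move=> Hs; apply: braid_equiv_invariant => {u v} u v l r lr.
by rewrite !eval_cat (eval_relator Hs lr).
Qed.

Lemma class_of_braid_relations m :
  braid_relations (fun i => class_of (braid_equiv_congruence m) [:: (i, true)]) m.
Proof.
pose s i := class_of (braid_equiv_congruence m) [:: (i, true)].
have E l r : relator m l r -> eval s l = eval s r.
  by move=> lr; rewrite !eval_class_of; apply/class_ofP/relator_equiv.
split=> [i k ik km|i im].
  by have := E _ _ (relator_far ik km); rewrite /= !mulg1.
by have := E _ _ (relator_braid im); rewrite /= !mulg1 !mulgA.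
Qed.

(** The universal property of the presentation. *)
Lemma braid_equivP m u v : braid_equiv m u v <->
  forall (G : groupType) (s : nat -> G), braid_relations s m -> eval s u = eval s v.
Proof.
split=> [uv G s Hs|E]; first exact: eval_braid_equiv Hs uv.
apply/(class_ofP (braid_equiv_congruence m)); rewrite -!eval_class_of.
exact/E/class_of_braid_relations.
Qed.

(** * Action of braids on a free group *)

(** The Artin automorphism attached to the signed braid generator [g], applied to a
    letter: it describes the conjugation by [g] of the loops of the last
    strand.  One formula serves a letter and its inverse, as
    the images are conjugates of letters. *)
Definition artin_gen (g a : gen) : seq gen :=
  let: (i, e) := g in let: (k, d) := a in
  if e then
    if k == i then [:: (i, true); (i.+1, d); (i, false)]
    else if k == i.+1 then [:: (i, d)] else [:: a]
  else
    if k == i then [:: (i.+1, d)]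
    else if k == i.+1 then [:: (i.+1, false); (i, d); (i.+1, true)] else [:: a].

Definition artin (g : gen) (f : seq gen) : seq gen := flatten [seq artin_gen g a | a <- f].

Definition artin_word (b f : seq gen) : seq gen := foldl (fun f g => artin g f) f b.

(** Splits on the comparisons of indices, discarding the inconsistent cases. *)
Ltac decide_tests :=
  repeat match goal with
  | |- context [@eq_op _ ?a ?b] =>
    case: (@eqP _ a b) => ?; try (exfalso; lia); try subst; simpl
  | |- context [leq ?a ?b] =>
    case: (leqP a b) => ?; try (exfalso; lia); simpl
  end.

Section Twist.
Variable G : groupType.
Implicit Type x : nat -> G.

(** Evaluating [artin g f] amounts to evaluating [f] at other elements
    of the group; the relations between Artin automorphisms thus become
    identities between families of group elements. *)
Definition twist (g : gen) x : nat -> G := fun k =>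
  let: (i, e) := g in
  if e then
    if k == i then x i * x i.+1 * (x i)^-1 else if k == i.+1 then x i else x k
  else
    if k == i then x i.+1 else
    if k == i.+1 then (x i.+1)^-1 * x i * x i.+1 else x k.

Lemma eval_artin g x f : eval x (artin g f) = eval (twist g x) f.
Proof.
elim: f => //= a f IH; rewrite eval_cat IH; congr (_ * _).
case: a => k d; case: g {IH} => i []; rewrite /eval_gen /=; case: eqP => [_|_].
- by case: d; rewrite /= /eval_gen /= ?mulg1 ?invgM ?invgK !mulgA.
- by case: eqP => [_|_]; case: d; rewrite /= /eval_gen /= mulg1.
- by case: d; rewrite /= /eval_gen /= mulg1.
- by case: eqP => [_|_]; case: d; rewrite /= /eval_gen /= ?mulg1 ?invgM ?invgK ?mulgA.
Qed.

Definition twist_word (b : seq gen) x := foldr twist x b.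

Lemma eval_artin_word b x f : eval x (artin_word b f) = eval (twist_word b x) f.
Proof. by elim: b f => //= g b IH f; rewrite IH eval_artin. Qed.

Lemma twist_relator m l r x : relator m l r -> twist_word l x = twist_word r x.
Proof.
case=> [[i []]|i k ik _|i _] /=; apply/funext => j; rewrite /twist /=;
  decide_tests; rewrite ?invgM ?invgK ?mulgA; rewrite ?mulVg ?mulgV ?mul1g ?mulgVK ?mulgK //.
Qed.
End Twist.

(** * Combing *)

(** A state [(j, (b, f))] stands for the braid b f c_j, where c_j brings the last
    strand to position [j], [b] does not involve the last strand and [f]
    is a word in the loops of the last strand around the other ones.  Multiplying
    by a generator moves the last strand, possibly completing a
    loop, or moves through c_j (with its index lowered if it is on the right of the last
    strand) and through [f] (by the Artin automorphism) to join [b]. *)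
Definition comb_step (st : nat * (seq gen * seq gen)) (g : gen) :=
  let: (j, (b, f)) := st in let: (i, e) := g in
  if i.+1 == j then (i, (b, if e then f else rcons f (i, false)))
  else if i == j then (i.+1, (b, if e then rcons f (i, true) else f))
  else let g' := (if j < i then i.-1 else i, e) in (j, (rcons b g', artin g' f)).

Definition comb st w := foldl comb_step st w.

(** In a braid with [m] generators the last strand has number [m]; removing it
    leaves the braid [b] with one generator less. *)
Fixpoint combed (m : nat) (w : seq gen) : seq (nat * seq gen) :=
  if m is p.+1 then
    let: (j, (b, f)) := comb (m, ([::], [::])) w in (j, norm f) :: combed p b
  else [::].

Lemma artin_cat g u v : artin g (u ++ v) = artin g u ++ artin g v.
Proof. by rewrite /artin map_cat flatten_cat. Qed.

Lemma artin_word_catl b c u : artin_word (b ++ c) u = artin_word c (artin_word b u).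
Proof. exact: foldl_cat. Qed.

(** Starting from the state of another braid multiplies on the left, where the
    free part has to be moved through the new [b']. *)
Lemma comb_base w j b f : comb (j, (b, f)) w =
  let: (j', (b', f')) := comb (j, ([::], [::])) w in
  (j', (b ++ b', artin_word b' f ++ f')).
Proof.
elim/last_ind: w => [|w [i e] IH]; first by rewrite /= !cats0.
rewrite /comb !foldl_rcons -!/(comb _ _) IH; case: (comb _ w) => j' [b' f'] /=.
case: eqP => _; first by case: e; rewrite -?rcons_cat.
case: eqP => _; first by case: e; rewrite -?rcons_cat.
by rewrite artin_cat -!cats1 !artin_word_catl catA.
Qed.

Lemma comb_cat st u v : comb st (u ++ v) = comb (comb st u) v.
Proof. exact: foldl_cat. Qed.

(** The two sides of a relation act in the same way on all states: by
    [comb_base] it is enough to start with empty words, which leaves finitely many relative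
    positions of [j] and the indices of the relation.  A relation not involving
    the last strand survives as a relation between the remaining braids. *)
Lemma comb_relator m l r j : relator m l r ->
  let: (j1, (b1, f1)) := comb (j, ([::], [::])) l in
  let: (j2, (b2, f2)) := comb (j, ([::], [::])) r in
  [/\ j1 = j2, b1 = b2 \/ relator m b1 b2 & norm f1 = norm f2].
Proof.
case=> [[i e]|i k ik km|i im]; rewrite /comb /= /inv_gen /=.
- by case: e; decide_tests; split=> //=; rewrite ?eqxx //;
    first [by left | right; exact: (relator_inv m (_, _))].
- by decide_tests; split=> //=; rewrite ?eqxx //;
    first [by left | right; apply: relator_far; lia | rewrite /artin /=; decide_tests].
- have braid a b : b = a.+1 -> b < m ->
      relator m [:: (a, true); (b, true); (a, true)] [:: (b, true); (a, true); (b, true)].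
    by move=> -> am; apply: relator_braid.
  decide_tests; split=> //=; rewrite ?eqxx //;
    first [by left | right; apply: braid; lia
      | rewrite /artin /=; decide_tests; rewrite ?xpair_eqE ?eqxx //].
Qed.

Lemma combed_relator m p l r u v : relator m l r ->
  combed p (u ++ l ++ v) = combed p (u ++ r ++ v).
Proof.
elim: p l r u v => //= p IH l r u v lr.
rewrite !(comb_cat _ u) !(comb_cat _ _ v); case: (comb _ u) => j [b f].
rewrite (comb_base l) (comb_base r); have := comb_relator j lr.
case El: (comb (j, _) l) => [j1 [b1 f1]]; case Er: (comb (j, _) r) => [j2 [b2 f2]].
move=> [<- b12 f12].
rewrite (comb_base v) [in RHS](comb_base v); case: (comb _ v) => j3 [b3 f3].
have bb x : combed p ((b ++ b1) ++ x) = combed p ((b ++ b2) ++ x).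
  by rewrite -!catA; case: b12 => [-> //|lr']; apply: IH lr'.
rewrite bb; congr ((_, _) :: _); apply/free_eqP => G x.
rewrite !eval_cat !eval_artin_word !eval_cat !eval_artin_word.
have /free_eqP-> := f12; congr (eval _ f * _ * _).
case: b12 => [-> //|lr']. exact: twist_relator lr'.
Qed.

Lemma combed_braid_equiv m p u v : braid_equiv m u v -> combed p u = combed p v.
Proof. by apply: braid_equiv_invariant => {}u {}v l r lr; apply: combed_relator lr. Qed.

(** * Combed forms determine braids *)

Definition bounded (m : nat) (w : seq gen) : bool := all (fun a => a.1 < m) w.

Section Coset.
Variables (G : groupType) (s : nat -> G).

(** The element s_(p-1) ... s_j, which brings the last strand from position [p]
    to position [j]. *)
Fixpoint coset_rep (p j : nat) : G :=
  if p is q.+1 then if j <= q then s q * coset_rep q j else 1 else 1.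

Lemma coset_rep_ge p j : p <= j -> coset_rep p j = 1.
Proof. by case: p => //= q qj; rewrite leqNgt qj. Qed.

Lemma coset_rep_split p k j : j <= k <= p -> coset_rep p j = coset_rep p k * coset_rep k j.
Proof.
elim: p => [|q IH] /andP[jk kp]; first by rewrite [k in RHS](_ : _ = 0) ?mulg1 //; lia.
have [->|kq] := eqVneq k q.+1; first by rewrite [in RHS]coset_rep_ge // mul1g.
have {kp}kq : k <= q by lia.
by rewrite /= kq (leq_trans jk kq) IH ?jk // mulgA.
Qed.

Lemma coset_rep_succ p j : j < p -> coset_rep p j = coset_rep p j.+1 * s j.
Proof.
move=> jp; rewrite (coset_rep_split (k := j.+1)) ?leqnSn //=.
by rewrite leqnn (@coset_rep_ge j j) ?mulg1.
Qed.

(** The last strand goes to position [k], around the strand there and back.  A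
    more symmetric form is c s_k^2 c^-1 with c = s_(p-1) ... s_(k+1). *)
Definition strand_loop (p k : nat) : G := coset_rep p k * s k * (coset_rep p k.+1)^-1.

Variables (p : nat) (Hs : braid_relations s p).

Lemma coset_rep_comm_low q j i : q <= p -> i.+1 < j ->
  s i * coset_rep q j = coset_rep q j * s i.
Proof.
move=> + ij; elim: q => [|q IH] qp; first by rewrite mulg1 mul1g.
rewrite /=; case: ifP => jq; last by rewrite mulg1 mul1g.
rewrite mulgA (proj1 Hs) //; last by lia.
by rewrite -mulgA IH ?mulgA //; lia.
Qed.

Lemma comm_coset_rep_high q j i : q < i -> i < p ->
  s i * coset_rep q j = coset_rep q j * s i.
Proof.
move=> qi ip; elim: q qi => [|q IH] qi; first by rewrite mulg1 mul1g.
rewrite /=; case: ifP => jq; last by rewrite mulg1 mul1g.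
rewrite mulgA -(proj1 Hs) //.
by rewrite -mulgA IH ?mulgA //; lia.
Qed.

(** A generator on the right of position [j] is moved past by the last strand
    and so loses one from its index; this is a single braid relation between
    commutations. *)
Lemma coset_rep_shift j k : j <= k -> k.+1 < p ->
  coset_rep p j * s k.+1 = s k * coset_rep p j.
Proof.
move=> jk kp; rewrite (coset_rep_split (k := k)); last by lia.
rewrite coset_rep_succ; last by lia.
rewrite coset_rep_succ; last by lia.
rewrite -!mulgA -comm_coset_rep_high // !mulgA (coset_rep_comm_low (j := k.+2)) //.
by congr (_ * _); rewrite -!mulgA; congr (_ * _); rewrite !mulgA (proj2 Hs).
Qed.

Local Notation A := (strand_loop p).

(** The four cases of the Artin automorphism.  The loops [i] and [i+1] are exchanged up
    to conjugation ([loop1]), and their product is fixed ([loop2]), being the part of a full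
    twist of three strands that does not involve the crossing of the first two. *)
Lemma loop_conj_pos i k : i.+1 < p -> k < p ->
  A k * s i = s i * twist (i, true) A k.
Proof.
move=> ip kp; set a := s i; set b := s i.+1; set c := coset_rep p i.+2.
have ca : a * c = c * a by apply: coset_rep_comm_low.
have cVa : c^-1 * a = a * c^-1 by apply/esym/commuteV.
have aba : a * b * a = b * a * b by apply: (proj2 Hs).
have Ai : A i = c * b * a * a * b^-1 * c^-1.
  by rewrite /strand_loop coset_rep_succ ?(ltnW ip) // coset_rep_succ // invgM !mulgA.
have Ai1 : A i.+1 = c * b * b * c^-1.
  by rewrite /strand_loop coset_rep_succ.
have loop1 : A i.+1 * a = a * A i.
  rewrite Ai Ai1 -!mulgA cVa !mulgA ca; congr (_ * _).
  by apply: (canRL (mulgK _)); rewrite -!mulgA; congr (_ * _); rewrite !mulgA aba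
    -(mulgA b a b) -(mulgA b (a * b) a) aba !mulgA.
have loop2 : A i * A i.+1 * a = a * (A i * A i.+1).
  rewrite Ai Ai1 !mulgA !mulgVK -!mulgA cVa !mulgA ca; congr (_ * _).
  rewrite -!mulgA; congr (_ * _); rewrite !mulgA.
  by rewrite aba -!mulgA [a * (b * a)]mulgA aba !mulgA.
rewrite /twist; case: eqP => [->|ki].
  move: loop1 loop2; move: (A i) (A i.+1) => X Y loop1 loop2.
  by apply: (mulIg X); rewrite mulgA mulgVK -mulgA -loop1 !mulgA loop2 !mulgA.
case: eqP => [->|ki1]; first exact: loop1.
have [ik|ik] := ltnP i.+1 k.
  apply/esym/commuteM; last exact/commuteV/coset_rep_comm_low/ltnW.
  by apply: commuteM; [apply: coset_rep_comm_low | apply: (proj1 Hs)].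
have shiftV : (coset_rep p k.+1)^-1 * a = b * (coset_rep p k.+1)^-1.
  have ki' : k < i by lia.
  by apply: (mulgI (coset_rep p k.+1)); rewrite mulVKg mulgA coset_rep_shift // mulgK.
rewrite /strand_loop -!mulgA shiftV !mulgA -coset_rep_shift //; last by lia.
by congr (_ * _); rewrite -!mulgA (proj1 Hs) //; lia.
Qed.

(** Formal consequence of [loop_conj_pos], since the two Artin automorphisms are
    inverse to each other. *)
Lemma loop_conj_neg i k : i.+1 < p -> k < p ->
  A k * (s i)^-1 = (s i)^-1 * twist (i, false) A k.
Proof.
move=> ip kp.
have Ei : A i * s i = s i * (A i * A i.+1 * (A i)^-1).
  by rewrite loop_conj_pos ?(ltnW ip) // /twist eqxx.
have Ei1 : A i.+1 * s i = s i * A i.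
  by rewrite loop_conj_pos // /twist eqxx; case: eqP => //; lia.
suff E : s i * A k = twist (i, false) A k * s i.
  by apply: (mulgI (s i)); rewrite mulVKg mulgA E mulgK.
rewrite /twist; case: eqP => [->|ki]; first by rewrite Ei1.
case: eqP => [->|ki1].
  move: (A i) (A i.+1) Ei Ei1 => X Y Ei Ei1.
  by rewrite -!mulgA Ei1 (mulgA X) Ei -!mulgA mulVg mulg1 (mulgA (s i)) -Ei1 -mulgA mulKg.
rewrite loop_conj_pos //= /twist.
by case: eqP => // _; case: eqP.
Qed.

Lemma loop_conj g f : g.1.+1 < p -> bounded p f ->
  eval A f * eval_gen s g = eval_gen s g * eval A (artin g f).
Proof.
case: g => i e ip; rewrite eval_artin.
elim: f => [|[k d] f IH] /=; first by rewrite mulg1 mul1g.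
case/andP=> kp fp; rewrite -mulgA IH // !mulgA; congr (_ * _).
have E : A k * eval_gen s (i, e) = eval_gen s (i, e) * twist (i, e) A k.
  by case: e {IH} ip => ip; [apply: loop_conj_pos | apply: loop_conj_neg].
case: d => //; rewrite {1 3}/eval_gen /=.
apply: (mulgI (A k)); rewrite mulVKg mulgA E.
by rewrite mulgK.
Qed.

(** The element that a state of the combing stands for. *)
Definition comb_value (st : nat * (seq gen * seq gen)) : G :=
  eval s st.2.1 * eval A st.2.2 * coset_rep p st.1.

Definition comb_bounded (st : nat * (seq gen * seq gen)) : bool :=
  [&& st.1 <= p, bounded p.-1 st.2.1 & bounded p st.2.2].

Lemma artin_bounded g f : g.1.+1 < p -> bounded p f -> bounded p (artin g f).
Proof.
case: g => i e /= ip; elim: f => //= [[k d] f] IH /andP[/= kp fp].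
rewrite /bounded all_cat [X in _ && X](IH fp) andbT.
by case: e {IH} => /=; case: ifP => _ /=; try (case: ifP => _ /=);
  rewrite ?kp /= ?ip ?(ltnW ip).
Qed.

Lemma comb_step_bounded st g : g.1 < p -> comb_bounded st -> comb_bounded (comb_step st g).
Proof.
case: st g => j [b f] [i e] /= ip /and3P[/= jp bp fp]; rewrite /comb_bounded /comb_step.
case: eqP => ij; last case: eqP => ij'.
- apply/and3P; split=> //=; first by lia.
  by case: e => //; rewrite /bounded all_rcons /= ip.
- apply/and3P; split=> //=.
  by case: e => //; rewrite /bounded all_rcons /= ip.
apply/and3P; split=> //=.
  by rewrite /bounded all_rcons [X in _ && X]bp andbT /=; case: (ltnP j i); lia.
by apply: artin_bounded => //=; case: (ltnP j i); lia.
Qed.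

Lemma comb_step_value st g : g.1 < p -> comb_bounded st ->
  comb_value (comb_step st g) = comb_value st * eval_gen s g.
Proof.
case: st g => j [b f] [i e] /= ip /and3P[/= jp bp fp]; rewrite /comb_value /comb_step /=.
case: eqP => ij; last case: eqP => ij'; rewrite /=.
- case: e; rewrite ?eval_rcons /eval_gen /= -!mulgA; do 2 congr (_ * _); subst j.
    by rewrite coset_rep_succ.
  by rewrite /strand_loop !invgM invgK -!mulgA mulVg mulg1.
- case: e; rewrite ?eval_rcons /eval_gen /= -!mulgA; do 2 congr (_ * _); subst j.
    by rewrite /strand_loop -?mulgA mulVg mulg1.
  by rewrite (@coset_rep_succ p i) // mulgK.
have E : coset_rep p j * eval_gen s (i, e) =
    eval_gen s (if j < i then i.-1 else i, e) * coset_rep p j.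
  have E : coset_rep p j * s i = s (if j < i then i.-1 else i) * coset_rep p j.
    case: (ltnP j i) => ji; last by rewrite coset_rep_comm_low //; lia.
    by case: i ip ij ij' ji => // i ip _ _ ji; rewrite coset_rep_shift.
  case: e => //; rewrite /eval_gen /=.
  apply: (mulIg (s i)); rewrite mulgVK -mulgA E.
  by rewrite mulKg.
rewrite eval_rcons -!mulgA E; congr (_ * _); rewrite !mulgA loop_conj //=.
by case: (ltnP j i); lia.
Qed.

Lemma comb_bounded_comb st w : bounded p w -> comb_bounded st -> comb_bounded (comb st w).
Proof.
elim: w st => //= g w IH st /andP[gp wp] st_b.
exact: IH _ wp (comb_step_bounded gp st_b).
Qed.

Lemma comb_valueM st w : bounded p w -> comb_bounded st ->
  comb_value (comb st w) = comb_value st * eval s w.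
Proof.
elim: w st => [|g w IH] st /=; first by rewrite mulg1.
case/andP=> gp wp st_b; rewrite (IH _ wp (comb_step_bounded gp st_b)).
by rewrite comb_step_value // mulgA.
Qed.
End Coset.

(** By [comb_valueM] a word has the value of its final state, whose components are all
    determined by the combed form: the free part through [free_eqP] and the
    remaining braid by induction. *)
Lemma combed_sound (G : groupType) (s : nat -> G) p u v : braid_relations s p ->
  bounded p u -> bounded p v -> combed p u = combed p v -> eval s u = eval s v.
Proof.
elim: p u v => [|p IH] u v Hs up vp; first by case: u v up vp => [|? ?] [].
have st0 : comb_bounded p.+1 (p.+1, ([::], [::])) by rewrite /comb_bounded /= leqnn.
have := comb_valueM Hs up st0; have := comb_valueM Hs vp st0.
have := comb_bounded_comb up st0; have := comb_bounded_comb vp st0.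
rewrite /comb_value /= ltnn !mul1g.
case: (comb _ u) => j [b f]; case: (comb _ v) => j' [b' f'] /=.
move=> /and3P[/= _ b'p _] /and3P[/= _ bp _] <- <- [<- ff' bb'].
have /free_eqP-> := ff'; congr (_ * _ * _); apply: IH => //.
exact: braid_relations_le Hs.
Qed.

Lemma combed_eq_braid_equiv m u v : bounded m u -> bounded m v ->
  combed m u = combed m v -> braid_equiv m u v.
Proof. by move=> um vm E; apply/braid_equivP => G s Hs; apply: combed_sound E. Qed.

(** * Growth of powers in free groups *)

Definition pow (w : seq gen) (k : nat) : seq gen := flatten (nseq k w).

Lemma powD w i j : pow w (i + j) = pow w i ++ pow w j.
Proof. by rewrite /pow nseqD flatten_cat. Qed.

Lemma powM w i j : pow w (i * j) = pow (pow w i) j.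
Proof. by elim: j => [|j IH]; rewrite ?muln0 // mulnS powD IH. Qed.

Lemma eval_pow (G : groupType) (x : nat -> G) w k : eval x (pow w k) = eval x w ^+ k.
Proof. by elim: k => //= k IH; rewrite eval_cat IH expgS. Qed.

Lemma bounded_cat m u v : bounded m (u ++ v) = bounded m u && bounded m v.
Proof. exact: all_cat. Qed.

Lemma bounded_pow m w k : bounded m w -> bounded m (pow w k).
Proof. by move=> wm; elim: k => //= k IH; rewrite bounded_cat wm. Qed.

Lemma size_norm w : size (norm w) <= size w.
Proof.
elim: w => //= a w; case: (norm w) => [|b t] //=; case: ifP => //= _; lia.
Qed.

Lemma reduced_pow a t k : reduced (a :: t) -> a != inv_gen (last a t) ->
  reduced (pow (a :: t) k).
Proof.
move=> st cyc; elim: k => //= k; rewrite /reduced /= cat_path [X in _ -> X && _]st.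
by case: k => //= k ->; rewrite cyc.
Qed.

(** If a reduced word is cyclically reduced, its powers are reduced as written.
    Otherwise it is a conjugate of a shorter word by its first letter, which changes the
    length of the powers by at most two. *)
Lemma free_power_growth f : norm f <> [::] ->
  exists D, forall k, k <= size (norm (pow f k)) + D.
Proof.
move: {2}(size _) (leqnn (size (norm f))) => n; elim: n f => [|n IH] f.
  by rewrite leqn0 size_eq0 => /eqP ->.
have normpow k : norm (pow f k) = norm (pow (norm f) k).
  by apply/free_eqP => G x; rewrite !eval_pow eval_norm.
have := norm_reduced f; case E: (norm f) => [//|a s] red size_s _.
have [cyc|] := boolP (a != inv_gen (last a s)).
  exists 0 => k; rewrite addn0 normpow E norm_id ?reduced_pow //.
  by rewrite size_flatten /shape map_nseq sumn_nseq /= mulSn leq_addr.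
rewrite negbK => /eqP a_last.
case/lastP: s => [|t b] in E red size_s a_last.
  by move: a_last => /=; case: (a) => i [].
rewrite last_rcons in a_last.
have b_eq : b = inv_gen a by rewrite a_last inv_genK.
have tR : reduced t.
  by move: red; rewrite /reduced /= -cats1 cat_path => /andP[/path_sorted].
have t0 : norm t <> [::].
  rewrite norm_id // => t0; move: red; rewrite t0 b_eq /= eqxx //.
have [|D HD] := IH t _ t0.
  by rewrite norm_id //; move: size_s; rewrite /= size_rcons; lia.
exists (D + 2) => k; apply: leq_trans (HD k) _.
have -> : norm (pow t k) = norm (inv_gen a :: norm (pow f k) ++ [:: a]).
  apply/free_eqP => G x; rewrite /= eval_cat eval_norm !eval_pow -(eval_norm x f) E.
  rewrite /= eval_rcons b_eq !eval_inv_gen mulg1 -[RHS]conjgE conjXg.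
  by rewrite conjgE !mulgA mulVg mul1g mulgVK.
have := size_norm (inv_gen a :: norm (pow f k) ++ [:: a]).
by rewrite /= size_cat /=; lia.
Qed.

(** * Growth of powers in braid groups *)

Definition position (j : nat) (w : seq gen) : nat := (comb (j, ([::], [::])) w).1.

Lemma position_cat j u v : position j (u ++ v) = position (position j u) v.
Proof.
rewrite /position comb_cat; case: (comb _ u) => j1 [b1 f1] /=.
by rewrite comb_base; case: (comb _ v) => ? [].
Qed.

Lemma position_inj w : injective (position^~ w).
Proof.
elim: w => [|[i e] w IH] j j' //=.
rewrite -cat1s !position_cat => /IH.
by rewrite /position /comb /=; decide_tests; lia.
Qed.

Lemma position_bounded m j w : bounded m w -> j <= m -> position j w <= m.
Proof.
elim: w j => [|[i e] w IH] j //= /andP[/= im wm] jm.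
rewrite -cat1s position_cat; apply: IH => //.
by rewrite /position /comb /=; decide_tests; lia.
Qed.

(** The last strand returns to its position because positions are permuted: among
    enough powers two give the same position, and [position_inj] cancels the smaller
    one. *)
Lemma position_pow m v : bounded m v -> exists2 q, 0 < q & position m (pow v q) = m.
Proof.
move=> vm.
pose F (i : 'I_m.+2) : 'I_m.+1 := inord (position m (pow v i)).
have /injectivePn : ~~ injectiveb F.
  apply/negP => /injectiveP /leq_card; rewrite !card_ord; lia.
case=> i [j ij Fij].
have : position m (pow v i) = position m (pow v j).
  move/(congr1 val): Fij.
  by rewrite /F /= !inordK // ltnS position_bounded //; apply: bounded_pow.
wlog {ij Fij} ij : i j / i < j.
  move: ij; rewrite -val_eqE neq_ltn => /orP[] ij H E; first exact: H E.
  exact: H (esym E).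
move=> E; exists (j - i); first by rewrite subn_gt0.
apply: (@position_inj (pow v i)); rewrite -position_cat -powD subnK ?(ltnW ij) //.
Qed.

(** An Artin automorphism at most triples the length of a word, and a step of
    the combing adds at most one loop. *)
Lemma comb_size j b f w : let: (j', (b', f')) := comb (j, (b, f)) w in
  size b' <= size b + size w /\ (size f').+1 <= (size f).+1 * 4 ^ size w.
Proof.
elim: w j b f => [|[i e] w IH] j b f; first by rewrite /= addn0 muln1.
rewrite -[comb _ _]/(comb (comb_step _ _) w) [comb_step _ _]/=.
have artin_size g : size (artin g f) <= 3 * size f.
  elim: f {IH} => //= a f IH; rewrite size_cat mulnS leq_add //.
  by case: g a {IH} => k [] [k' d] /=; do ![case: ifP => //= _].
have step (f0 : seq gen) : size f0 <= 3 * size f + 1 ->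
    (size f0).+1 * 4 ^ size w <= (size f).+1 * 4 ^ (size w).+1.
  by move=> sf; rewrite expnS mulnA leq_mul2r; apply/orP; right; lia.
case: eqP => _; last case: eqP => _.
- have := IH i b (if e then f else rcons f (i, false)).
  case: (comb _ w) => j' [b' f'] /= [sb sf]; split; first by lia.
  by apply: leq_trans sf (step _ _); case: (e); rewrite ?size_rcons; lia.
- have := IH i.+1 b (if e then rcons f (i, true) else f).
  case: (comb _ w) => j' [b' f'] /= [sb sf]; split; first by lia.
  by apply: leq_trans sf (step _ _); case: (e); rewrite ?size_rcons; lia.
set g := (_, e).
have := IH j (rcons b g) (artin g f).
case: (comb _ w) => j' [b' f'] /= [sb sf]; split; first by rewrite size_rcons in sb; lia.
by apply: leq_trans sf (step _ _); have := artin_size g; lia.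
Qed.

Lemma artin_word_braid_equiv m b f : braid_equiv m b [::] -> norm (artin_word b f) = norm f.
Proof.
move=> b1; apply/free_eqP => G x; rewrite eval_artin_word.
suff -> : twist_word b x = twist_word [::] x by [].
apply: braid_equiv_invariant b1 => u v l r lr.
by rewrite /twist_word !foldr_cat -!/(twist_word _ _) (twist_relator _ lr).
Qed.

Lemma braid_equiv_pow_nil m w k : braid_equiv m w [::] -> braid_equiv m (pow w k) [::].
Proof.
move=> w1; elim: k => [|k IH]; first exact: rst_refl.
exact: (wc_cat (braid_equiv_congruence m) (u' := [::]) (v' := [::])).
Qed.

(** If the remaining braid [b] is trivial, its Artin automorphism is the identity, and
    the free part of a power is the power of the free part. *)
Lemma comb_pow m y b f k : comb (m, ([::], [::])) y = (m, (b, f)) ->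
  exists2 F, comb (m, ([::], [::])) (pow y k) = (m, (pow b k, F)) &
    forall p, braid_equiv p b [::] -> norm F = norm (pow f k).
Proof.
move=> Ey; elim: k => [|k [F EF HF]]; first by exists [::].
exists (artin_word (pow b k) f ++ F).
  by rewrite [pow y _]/= comb_cat Ey comb_base EF.
move=> p b1; have := HF p b1 => normF.
rewrite -norm_catl (artin_word_braid_equiv _ (braid_equiv_pow_nil k b1)) norm_catl.
by rewrite -norm_catr normF norm_catr.
Qed.

(** A braid of infinite order has powers that cannot be written by short words.
    [D] absorbs the cyclic reduction of a free word, which depends on [v] and not
    on [x]. *)
Theorem power_growth m v : bounded m v ->
  exists q D, 0 < q /\ (braid_equiv m (pow v q) [::] \/
    forall k x, bounded m x -> braid_equiv m (pow v (q * k)) x -> k <= 4 ^ size x + D).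
Proof.
elim: m v => [|m IH] v vm.
  exists 1%N, 0%N; split=> //; left; case: v vm => // _; exact: rst_refl.
have [q1 q1_gt0 Eq1] := position_pow vm.
pose y := pow v q1.
have split w : bounded m.+1 w -> exists j b f,
    [/\ comb (m.+1, ([::], [::])) w = (j, (b, f)), bounded m b,
        size b <= size w & size f <= 4 ^ size w].
  move=> wm; have st0 : comb_bounded m.+1 (m.+1, ([::], [::])).
    by rewrite /comb_bounded /= leqnn.
  have := comb_bounded_comb wm st0.
  have := comb_size m.+1 [::] [::] w; case: (comb _ w) => j [b f] /= [sb sf] /and3P[_ bb _].
  by exists j, b, f; split=> //; move: sf; rewrite mul1n; lia.
have [j [b [f [Ey bm _ _]]]] := split _ (bounded_pow q1 vm).
have jm : j = m.+1 by rewrite -Eq1 /position Ey.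
subst j.
have [q2 [D [q2_gt0 Hb]]] := IH b bm.
(* [y] fixes the last strand and leaves [b]; the induction hypothesis decides
   whether the remaining braids of its powers tell the exponent. *)
have [F EF HF] := comb_pow q2 Ey.
case: Hb => [b1|Hb]; last first.
  exists (q1 * q2)%N, D; split; first by rewrite muln_gt0 q1_gt0.
  right=> k x xm Ex; have [j [bx [fx [Exx bxm sb _]]]] := split x xm.
  have [F' EF' _] := comb_pow (q2 * k) Ey.
  have /= := combed_braid_equiv m.+1 Ex; rewrite -mulnA powM EF' Exx => -[_ _ Eb].
  have := Hb k bx bxm (combed_eq_braid_equiv (bounded_pow _ bm) bxm Eb).
  by move/leq_trans; apply; rewrite leq_add2r leq_exp2l.
have [F1|F1] := eqVneq (norm F) [::].
  exists (q1 * q2)%N, 0; split; first by rewrite muln_gt0 q1_gt0.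
  left; apply: combed_eq_braid_equiv => //; first exact: bounded_pow.
  by rewrite powM /= EF F1 (combed_braid_equiv m b1).
have [D' HD] := free_power_growth (elimN eqP F1).
exists (q1 * q2)%N, D'; split; first by rewrite muln_gt0 q1_gt0.
right=> k x xm Ex; have [j [bx [fx [Exx bxm _ sf]]]] := split x xm.
have [F' EF' HF'] := comb_pow k EF.
have /= := combed_braid_equiv m.+1 Ex; rewrite !powM EF' Exx => -[_ Ef _].
apply: leq_trans (HD k) _; rewrite leq_add2r.
rewrite -(HF' _ b1) Ef; exact: leq_trans (size_norm _) sf.
Qed.

Local Close Scope group_scope.
Local Close Scope quotient_scope.

(** * Generations as finite automaton states *)

(** A cell without its strand numbers: occupation of the left and of the right
    position, whether the strands turn, whether a crossing is of kind [T2]. *)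
Definition skeleton := ((bool * bool) * (bool * bool))%type.
Definition sk_empty : skeleton := ((false, false), (false, false)).

Section Trim.
Implicit Types s t : seq skeleton.

Definition strip s := drop (find (predC1 sk_empty) s) s.
Definition trim s := rev (strip (rev (strip s))).

(** Rows of cells extend to infinity on both sides; children are shifted by half
    a cell, so indices have to range over all integers. *)
Definition at_index s (k : int) : skeleton :=
  if k is Posz i then nth sk_empty s i else sk_empty.

Lemma strip_nseq k s : strip (nseq k sk_empty ++ s) = strip s.
Proof. by elim: k. Qed.

Lemma stripE s : exists k, s = nseq k sk_empty ++ strip s.
Proof.
elim: s => [|x s [k E]]; first by exists 0.
rewrite /strip /=; case: eqP => [->|_]; last by exists 0.
by exists k.+1; rewrite /= {1}E.
Qed.

Lemma strip_cat_nseq s k :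
  strip (s ++ nseq k sk_empty) = strip s ++ nseq k sk_empty \/
  strip (s ++ nseq k sk_empty) = [::] /\ strip s = [::].
Proof.
elim: s => [|x s IH] /=; first by right; rewrite -[nseq k _]cats0 strip_nseq.
by rewrite /strip /=; case: eqP => [_|_]; [apply: IH | left].
Qed.

Lemma trimE s : exists a b, s = nseq a sk_empty ++ trim s ++ nseq b sk_empty.
Proof.
have [a Ea] := stripE s; have [b Eb] := stripE (rev (strip s)).
exists a, b; rewrite {1}Ea; congr (_ ++ _).
by rewrite -[LHS]revK {1}Eb rev_cat rev_nseq.
Qed.

Lemma trim_pad a b s : trim (nseq a sk_empty ++ s ++ nseq b sk_empty) = trim s.
Proof.
rewrite /trim strip_nseq; case: (strip_cat_nseq s b) => [->|[-> ->] //].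
by rewrite rev_cat rev_nseq strip_nseq.
Qed.

Lemma strip_head s : strip s != [::] -> nth sk_empty (strip s) 0 != sk_empty.
Proof.
rewrite /strip nth_drop addn0 => nz; apply: (@nth_find _ sk_empty (predC1 sk_empty)).
rewrite has_find; apply: contraNT nz; rewrite -leqNgt => /drop_oversize ->//.
Qed.

Lemma trim_ends s : trim s != [::] -> nth sk_empty (trim s) 0 != sk_empty /\
  nth sk_empty (trim s) (size (trim s)).-1 != sk_empty.
Proof.
move=> nz; have nz' : strip (rev (strip s)) != [::].
  by apply: contraNneq nz => E; rewrite /trim E.
have sz : 0 < size (strip (rev (strip s))) by rewrite lt0n size_eq0.
split; last first.
  by rewrite /trim size_rev nth_rev ?prednK // subnn strip_head.
have [k Ek] := stripE (rev (strip s)).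
have E : strip s = trim s ++ nseq k sk_empty.
  by rewrite -[LHS]revK {1}Ek rev_cat rev_nseq.
have := @strip_head s; rewrite E nth_cat size_rev sz; apply.
by case: (trim s) nz.
Qed.

Lemma trim_nth s t : nth sk_empty s =1 nth sk_empty t -> trim s = trim t.
Proof.
move=> E; rewrite -[LHS](trim_pad 0 (size t)) -[RHS](trim_pad 0 (size s)) /=.
congr trim; apply: (@eq_from_nth _ sk_empty) => [|i _].
  by rewrite !size_cat !size_nseq addnC.
have pad u k : nth sk_empty (u ++ nseq k sk_empty) i = nth sk_empty u i.
  by rewrite nth_cat nth_nseq if_same; case: ltnP => // ui; rewrite nth_default.
by rewrite !pad E.
Qed.

Import GRing.Theory.
Local Open Scope ring_scope.

(** Trimming forgets translations and the choice of the window. *)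
Lemma trim_shift s t (d : int) :
  (forall k, at_index s k = at_index t (k + d)) -> trim s = trim t.
Proof.
wlog [d' Ed] : s t d / exists d', d = Posz d'.
  case: d => [d'|d'] H E; first by apply: (H s t d' _ E); exists d'.
  apply/esym/(H t s (Posz d'.+1)) => [|k]; first by exists d'.+1.
  by rewrite E NegzE addrK.
move=> E; rewrite -(trim_pad d' 0 s) cats0; apply: trim_nth => i.
rewrite nth_cat size_nseq nth_nseq; case: ltnP => di.
  have := E (Posz i - Posz d'); rewrite Ed subrK /= => <-.
  by case Ek: (Posz i - Posz d') => [k|k] //; lia.
have := E (Posz (i - d')%N); rewrite Ed /= => ->.
by rewrite subnK.
Qed.

Lemma at_index_pad a b s k :
  at_index (nseq a sk_empty ++ s ++ nseq b sk_empty) k = at_index s (k - Posz a).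
Proof.
have at_neg t (i : int) : i < 0 -> at_index t i = sk_empty by case: i.
case: k => [k|k]; last by rewrite (at_neg s) //; lia.
rewrite [LHS]/= nth_cat size_nseq nth_nseq; case: ltnP => ka.
  by rewrite at_neg //; lia.
have -> : Posz k - Posz a = Posz (k - a)%N by lia.
rewrite /= nth_cat nth_nseq if_same; case: ltnP => // ?; by rewrite nth_default.
Qed.

(** One more cell than in [s]: the first cell has a child with the empty cell
    on its left, and the last one with the empty cell on its right. *)
Definition children (F : skeleton -> skeleton -> skeleton) s :=
  pairmap F sk_empty (rcons s sk_empty).

Lemma at_children F s k : F sk_empty sk_empty = sk_empty ->
  at_index (children F s) k = F (at_index s (k - 1)) (at_index s k).
Proof.
move=> F0; case: k => [[|k]|k]; last by rewrite /= F0.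
  by rewrite /children /=; case: s.
have -> : Posz k.+1 - 1 = Posz k by lia.
rewrite /= /children.
have [ks|sk] := ltnP k (size s).
  by rewrite (nth_pairmap sk_empty) ?size_rcons //= !nth_rcons_default.
rewrite (nth_default _ sk) (nth_default _ (leqW sk)) F0 nth_default //.
by rewrite size_pairmap size_rcons.
Qed.
End Trim.

Section Rows.
Variable n : nat.
Implicit Types (C : cell n) (G : cell_row n) (g : seq (cell_row n)).

Definition skeleton_of C : skeleton :=
  ((left_occupied C, right_occupied C),
   (if cell_turning C is Some Turn then true else false,
    if cell_crossing C is Some T2 then true else false)).

Definition sk_sent_right (x : skeleton) : option turning :=
  let: ((l, r), (t, _)) := x in
  if t then if l then Some Turn else None else if r then Some Straight else None.

Definition sk_sent_left (x : skeleton) : option turning :=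
  let: ((l, r), (t, _)) := x in
  if t then if r then Some Turn else None else if l then Some Straight else None.

Definition sk_crossing (x : skeleton) : option crossing :=
  let: ((l, r), (t, k)) := x in
  if [&& l, r & t] then Some (if k then T2 else T1) else None.

Lemma sent_rightE C : sent_right C = sk_sent_right (skeleton_of C).
Proof. by case: C => // -[]. Qed.
Lemma sent_leftE C : sent_left C = sk_sent_left (skeleton_of C).
Proof. by case: C => // -[]. Qed.
Lemma cell_crossingE C : cell_crossing C = sk_crossing (skeleton_of C).
Proof. by case: C => // -[]. Qed.

Definition child (tau : option turning -> option turning -> turning)
    (kappa : option crossing -> option crossing -> crossing)
    (a b : skeleton) : skeleton :=
  let l := isSome (sk_sent_right a) in let r := isSome (sk_sent_left b) in
  let t := (l || r) &&
    (if tau (sk_sent_right a) (sk_sent_left b) is Turn then true else false) in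
  ((l, r), (t, [&& l, r, t &
     if kappa (sk_crossing a) (sk_crossing b) is T2 then true else false])).

(** An empty cell and a cell without crossing are also determined: the occupations
    are given by continuity, and the rules matter only when a strand or a crossing
    is present. *)
Lemma skeleton_child tau kappa A B C :
  left_occupied C = isSome (sent_right A) -> right_occupied C = isSome (sent_left B) ->
  (forall s, cell_turning C = Some s -> s = tau (sent_right A) (sent_left B)) ->
  (forall c, cell_crossing C = Some c -> c = kappa (cell_crossing A) (cell_crossing B)) ->
  skeleton_of C = child tau kappa (skeleton_of A) (skeleton_of B).
Proof.
rewrite /child -sent_rightE -sent_leftE -!cell_crossingE => HA HB Ht Hk.
rewrite -HA -HB /skeleton_of; move: Ht Hk {HA HB}.
case: C => [|i|i|i|i|i|k i] /= Ht Hk;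
  by rewrite -?(Ht _ erefl) -?(Hk _ erefl).
Qed.

Definition row_skeleton G : seq skeleton := map skeleton_of (window G).

Lemma at_row_skeleton G k : at_index (row_skeleton G) k = skeleton_of (cell_at G k).
Proof.
case: k => [k|k] //=; have [kG|Gk] := ltnP k (size (window G)).
  by rewrite (nth_map Empty).
by rewrite !nth_default // size_map.
Qed.

Definition child_fun tau kappa : {ffun skeleton * skeleton -> skeleton} :=
  [ffun p => child tau kappa p.1 p.2].

(** Indexed by a finite function rather than by the two rules, so that there are
    finitely many evolutions. *)
Definition next_state (F : {ffun skeleton * skeleton -> skeleton}) (s : seq skeleton) :=
  trim (children (fun a b => F (a, b)) s).

Import GRing.Theory.

Lemma trim_children F s : F sk_empty sk_empty = sk_empty ->
  trim (children F s) = trim (children F (trim s)).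
Proof.
move=> F0; have [a [b E]] := trimE s.
apply: (@trim_shift _ _ (- Posz a)%R) => k.
rewrite !at_children // {1 2}E !at_index_pad; congr (F (at_index _ _) _).
by rewrite addrAC.
Qed.

(** Continuity places the cells of [G'] at a constant distance [k0] from their
    parents, so the trimmed rows do not depend on positions. *)
Lemma trim_next g tau kappa G G' :
  continuous_pattern g -> turning_rule_of g tau -> crossing_rule_of g kappa ->
  consecutive g G G' ->
  trim (row_skeleton G') = next_state (child_fun tau kappa) (trim (row_skeleton G)).
Proof.
move=> [Hex Hocc] Htau Hkappa GG'.
have [k0 Hk0] := Hex _ _ GG' (Posz 0).
pose F a b := child_fun tau kappa (a, b).
have F0 : F sk_empty sk_empty = sk_empty by rewrite /F ffunE.
rewrite /next_state -[trim (children _ (trim _))](trim_children _ F0).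
apply: (@trim_shift _ _ (k0 + 1)%R) => k.
rewrite at_children // !at_row_skeleton.
have idx : child_index G (k + k0)%R G' k.
  by move: Hk0; rewrite /child_index /left_pos; lia.
have [oA oB] := Hocc _ _ GG' _ _ idx.
rewrite (_ : (k + (k0 + 1) - 1)%R = (k + k0)%R); last by lia.
rewrite (_ : (k + (k0 + 1))%R = (k + k0 + 1)%R); last by lia.
rewrite /F ffunE /=; apply: skeleton_child => //; first exact: Htau idx.
exact: Hkappa idx.
Qed.

(** * Words of generations *)

(** [c] counts the strands met so far, which gives the number of the next one. *)
Fixpoint state_word (c : nat) (s : seq skeleton) : seq gen :=
  if s is x :: s' then
    let: ((l, r), (t, k)) := x in
    (if [&& l, r & t] then [:: (c, ~~ k)] else [::]) ++ state_word (c + l + r) s'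
  else [::].

Definition gen_of_letter (l : letter n) : gen :=
  (l.1 : nat, if l.2 is Pos then true else false).

Definition gens (w : word n) : seq gen := map gen_of_letter w.

Lemma state_word_nseq c k s : state_word c (nseq k sk_empty ++ s) = state_word c s.
Proof. by elim: k => //= k IH; rewrite !addn0. Qed.

Lemma state_word_trim c s : state_word c (trim s) = state_word c s.
Proof.
have [a [b {2}->]] := trimE s; rewrite state_word_nseq.
elim: (trim s) c => [|[[l r] [t k]] s' IH] c /=; last by rewrite IH.
by rewrite -[nseq b _]cats0 state_word_nseq.
Qed.

Lemma state_word_cells (cs : seq (cell n)) c N :
  flatten [seq [seq s.2 | s <- cell_strands 0%R C] | C <- cs] = iota c N ->
  gens (flatten [seq cell_word C | C <- cs]) = state_word c (map skeleton_of cs).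
Proof.
elim: cs c N => //= C cs IH c N; rewrite /gens map_cat -/(gens _).
case: C => [|i|i|i|i|t|k t] /=; rewrite ?addn0 ?addn1.
- exact: IH.
- by case: N => //= N [_]; apply: IH.
- by case: N => //= N [_]; apply: IH.
- by case: N => //= N [_]; apply: IH.
- by case: N => //= N [_]; apply: IH.
- by case: N => [|[|N]] //= [_ _]; apply: IH.
- case: N => [|[|N]] //= [E _ /IH]; rewrite /gens.
  by case: k => /= ->; rewrite /gen_of_letter /= E.
Qed.

Lemma row_word G : is_generation G ->
  gens (flatten [seq cell_word C | C <- window G]) = state_word 0 (row_skeleton G).
Proof.
move/eqP => E; apply: (@state_word_cells _ _ n).
rewrite -{}E /row_strands map_flatten -map_comp.
rewrite -{1}[window G](mkseq_nth Empty) /mkseq -map_comp; congr flatten.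
by apply: eq_map => m /=; case: (nth _ _ _).
Qed.

(** * Size of compact generations *)

Local Open Scope ring_scope.

Fixpoint positions (p : int) (cs : seq (cell n)) : seq int :=
  if cs is C :: cs' then [seq s.1 | s <- cell_strands p C] ++ positions (p + 2) cs' else [::].

Lemma row_positions G : [seq s.1 | s <- row_strands G] = positions (row_start G) (window G).
Proof.
rewrite /row_strands /left_pos map_flatten -map_comp /cell_at.
elim: (window G) (row_start G) => //= C cs IH p; rewrite mul0r addr0; congr (_ ++ _).
rewrite -IH (iotaDl 1 0) -map_comp; congr flatten; apply: eq_map => m /=.
by congr [seq s.1 | s <- cell_strands _ _]; rewrite add1n intS mulrDl mul1r addrA.
Qed.

(** Together with [positions_last], this compares the extreme positions of
    the strands with those of any nonempty cells. *)
Lemma positions_head p cs i : skeleton_of (nth Empty cs i) != sk_empty ->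
  head 0 (positions p cs) <= p + 2 * Posz i + 1.
Proof.
elim: cs p i => [|C cs IH] p [|i] //=.
  by case: C => [|j|j|j|j|j|k j] //= _; lia.
move/(IH (p + 2)) => H; case: C => [|j|j|j|j|j|k j] /=; try lia.
by move: (head _ _) H => x; lia.
Qed.

Lemma positions_last p cs i d : skeleton_of (nth Empty cs i) != sk_empty ->
  p + 2 * Posz i <= last d (positions p cs).
Proof.
elim: cs p i d => [|C cs IH] p [|i] d; rewrite ?nth_nil //= last_cat; last first.
  move=> H; have {H} := IH (p + 2) i (last d [seq s.1 | s <- cell_strands p C]) H.
  by move: (last _ _) => x; lia.
have ge q : p <= q -> forall d, p <= d -> p <= last d (positions q cs).
  elim: {C IH} cs q => // C cs IH q pq d' pd; rewrite /= last_cat; apply: IH; first by lia.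
  by case: C => [|j|j|j|j|j|k j] /=; lia.
move=> C0; rewrite mulr0 addr0; apply: ge; first by lia.
by case: C C0 => [|j|j|j|j|j|k j] //= _; lia.
Qed.

(** The first and the last nonempty cells of a row contain strands at distance
    at most [n.-1], so about n / 2 cells lie between them; [n.+1] is a convenient bound. *)
Lemma size_trim_row G : (0 < n)%N -> is_generation G -> compact_pattern [:: G] ->
  (size (trim (row_skeleton G)) <= n.+1)%N.
Proof.
move=> n_gt0 gG; rewrite /= andbT row_positions => /eqP cpt.
have [->//|nz] := eqVneq (trim (row_skeleton G)) [::].
have [h l] := trim_ends nz; have [a [b E]] := trimE (row_skeleton G).
set c := trim _ in nz h l E *.
have nthE i : (i < size c)%N -> skeleton_of (nth Empty (window G) (a + i)) = nth sk_empty c i.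
  move=> ic; rewrite -[LHS](at_row_skeleton G (Posz (a + i))) E /= nth_cat size_nseq.
  by rewrite ltnNge leq_addr /= addKn nth_cat ic.
have c_gt0 : (0 < size c)%N by rewrite lt0n size_eq0.
have Hh := @positions_head (row_start G) (window G) (a + 0); rewrite nthE // in Hh.
have Hl := @positions_last (row_start G) (window G) (a + (size c).-1) 0.
rewrite nthE ?prednK // in Hl.
move: (Hh h) (Hl l) cpt; move: (head _ _) (last _ _) (size c) c_gt0 => x y z; lia.
Qed.
End Rows.

(** * Compact patterns as orbits *)

Section Evolution.
Variable n : nat.
Hypothesis n_gt0 : 0 < n.
Implicit Types (G : cell_row n) (g : seq (cell_row n)) (w : word n).

Lemma gens_cat (u v : word n) : gens (u ++ v) = gens u ++ gens v.
Proof. exact: map_cat. Qed.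

(** Letters that are not generators of the braid group are dropped; as an index
    is dropped together with its inverse, equivalence is preserved. *)
Definition lift_gen (a : gen) : option (letter n) :=
  omap (fun t => (t, if a.2 then Pos else Neg)) (insub a.1).

Lemma lift_gen_of_letter (l : letter n) : lift_gen (gen_of_letter l) = Some l.
Proof. by case: l => t []; rewrite /lift_gen /= valK. Qed.

Lemma pmap_gens w : pmap lift_gen (gens w) = w.
Proof. by elim: w => //= l w IH; rewrite lift_gen_of_letter /= -/(gens w) IH. Qed.

Lemma lift_genE i e (i_lt : i < n.-1) :
  lift_gen (i, e) = Some (Ordinal i_lt, if e then Pos else Neg).
Proof. by rewrite /lift_gen /= insubT. Qed.

Lemma braid_relator_equiv (l r : word n) :
  braid_relator l r -> braid_equiv n.-1 (gens l) (gens r).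
Proof.
case=> [t|t|s t /orP[] st|s t st].
- exact: relator_equiv (relator_inv _ (_, true)).
- exact: relator_equiv (relator_inv _ (_, false)).
- by apply/relator_equiv/relator_far.
- by apply/rst_sym/relator_equiv/relator_far.
- have := ltn_ord t; rewrite /gens /= /gen_of_letter /= st => sn.
  exact/relator_equiv/relator_braid.
Qed.

Lemma relator_braid_eq l r : relator n.-1 l r ->
  braid_eq (pmap lift_gen l) (pmap lift_gen r).
Proof.
have E (l' r' : word n) : braid_relator l' r' -> braid_eq l' r'.
  by move=> lr; apply: rst_step; rewrite -[l']cats0 -[r']cats0; apply: (Braid_step [::] [::]).
case=> [[i e]|i k ik kn|i i_n].
- have [i_n|ni] := ltnP i n.-1; last first.
    by rewrite /= /lift_gen /= insubF ?ltnNge ?ni //; apply: rst_refl.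
  rewrite /= !(lift_genE _ i_n); case: e; apply: E.
    exact: Relator_mulV.
  exact: Relator_mulVl.
- have i_n : i < n.-1 by lia.
  rewrite /= !(lift_genE _ i_n) !(lift_genE _ kn); apply: E.
  by apply: Relator_far; rewrite /= ik.
- have i_n' : i < n.-1 by lia.
  by rewrite /= !(lift_genE _ i_n) !(lift_genE _ i_n'); apply: E; apply: Relator_braid.
Qed.

Lemma braid_eqP w w' : braid_eq w w' <-> braid_equiv n.-1 (gens w) (gens w').
Proof.
split.
  elim=> [_ _ [u v l r lr]|u|u v _ IH|u v x _ IH _ IH']; last exact: rst_trans IH IH'.
  - have H := braid_equiv_congruence n.-1; rewrite !gens_cat.
    apply: (wc_cat H (wc_refl H _)); apply: (wc_cat H _ (wc_refl H _)).
    exact: braid_relator_equiv.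
  - exact: rst_refl.
  - exact: rst_sym.
rewrite -{2}(pmap_gens w) -{2}(pmap_gens w').
elim=> [_ _ [u v l r lr]|u|u v _ IH|u v x _ IH _ IH']; last exact: rst_trans IH IH'.
- rewrite !pmap_cat; elim: (relator_braid_eq lr)
    => [_ _ [u' v' l' r' lr']|x|x y _ IH|x y z _ IH _ IH'].
  + by rewrite -!catA !(catA (pmap _ u)); apply: rst_step; apply: Braid_step.
  + exact: rst_refl.
  + exact: rst_sym.
  + exact: rst_trans IH IH'.
- exact: rst_refl.
- exact: rst_sym.
Qed.

Lemma gens_bounded w : bounded n.-1 (gens w).
Proof. by rewrite /bounded; elim: w => //= l w ->; rewrite ltn_ord. Qed.

Definition governed tau kappa g : Prop :=
  [/\ grid_pattern g, continuous_pattern g, turning_rule_of g tau,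
      crossing_rule_of g kappa & compact_pattern g].

Lemma consecutive_cat g1 g2 G G' : consecutive g1 G G' -> consecutive (g1 ++ g2) G G'.
Proof. by case=> a [b ->]; exists a, (b ++ g2); rewrite -catA. Qed.

Lemma consecutive_catr g1 g2 G G' : consecutive g2 G G' -> consecutive (g1 ++ g2) G G'.
Proof. by case=> a [b ->]; exists (g1 ++ a), b; rewrite -catA. Qed.

Lemma governed_take tau kappa g m : governed tau kappa g -> governed tau kappa (take m g).
Proof.
case=> gp [Hex Hocc] Ht Hk cp.
have sub G G' : consecutive (take m g) G G' -> consecutive g G G'.
  by rewrite -{2}(cat_take_drop m g); apply: consecutive_cat.
split.
- by move: gp; rewrite -{1}(cat_take_drop m g) /grid_pattern all_cat => /andP[].
- by split=> [G G' /sub /Hex|G G' /sub /Hocc].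
- by move=> G G' /sub /Ht.
- by move=> G G' /sub /Hk.
- by move: cp; rewrite -{1}(cat_take_drop m g) /compact_pattern all_cat => /andP[].
Qed.

Definition states g : seq (seq skeleton) := [seq trim (row_skeleton G) | G <- g].

Lemma states_traject tau kappa g c : governed tau kappa g -> head c (states g) = c ->
  states g = traject (next_state (child_fun tau kappa)) c (size g).
Proof.
case=> _ Hc Ht Hk _.
have: forall G G', consecutive g G G' ->
    trim (row_skeleton G') = next_state (child_fun tau kappa) (trim (row_skeleton G)).
  by move=> G G'; apply: trim_next.
elim: g c {Hc Ht Hk} => //= G g IH c step <-; congr cons.
apply: IH => [G1 G1' cons1|]; first by apply: step; apply: (@consecutive_catr [:: G]).
by case: g step => //= G1 g step; apply: step; exists [::], g.
Qed.

Definition stage (F : {ffun skeleton * skeleton -> skeleton}) c m : seq gen :=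
  flatten [seq state_word 0 s | s <- traject (next_state F) c m].

(** The condition on [head] says that [g] starts in state [c] if it is not
    empty. *)
Definition reaches F c m : Prop := exists tau kappa g,
  [/\ governed tau kappa g, F = child_fun tau kappa, size g = m & head c (states g) = c].

Lemma psi_stage tau kappa g : governed tau kappa g ->
  gens (psi g) = flatten [seq state_word 0 s | s <- states g].
Proof.
case=> + _ _ _ _; rewrite /psi; elim: g => //= G g IH /andP[gG gg].
by rewrite gens_cat IH // row_word // state_word_trim.
Qed.

Lemma reaches_leq F c m m' : m' <= m -> reaches F c m -> reaches F c m'.
Proof.
move=> mm' [tau [kappa [g [Hg -> gm Hc]]]]; exists tau, kappa, (take m' g).
split=> //; first exact: governed_take.
  by rewrite size_takel // gm.
by rewrite /states map_take -/(states g); case: (states g) Hc; case: (m').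
Qed.

Lemma size_states tau kappa g s : governed tau kappa g -> s \in states g -> size s <= n.+1.
Proof.
case=> gp _ _ _ cp; elim: g gp cp => //= G g IH /andP[gG gg] /andP[cG cg].
rewrite inE => /orP[/eqP ->|]; last exact: IH.
by apply: size_trim_row; rewrite //= cG.
Qed.

(** [F] and [c] range over finite types, and for given [F] and [c] the word depends
    on the number of generations only. *)
Lemma representationP w : has_compact_SCA_representation w <->
  exists (F : {ffun skeleton * skeleton -> skeleton}) (c : n.+1.-bseq skeleton) m,
    reaches F c m /\ braid_equiv n.-1 (stage F c m) (gens w).
Proof.
split.
  case=> g [[gp gc [tau Ht] [kappa Hk]] cp /braid_eqP E].
  have Hg : governed tau kappa g by [].
  pose c := insub_bseq n.+1 (head [::] (states g)).
  have Ec : head (c : seq skeleton) (states g) = c.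
    case Eg: (states g) => [|s ss] //=; rewrite /c Eg /= /insub_bseq insubdK //.
    by apply: (size_states Hg); rewrite Eg mem_head.
  exists (child_fun tau kappa), c, (size g); split; first by exists tau, kappa, g.
  by rewrite /stage -(states_traject Hg Ec) -(psi_stage Hg).
case=> F [c [m [[tau [kappa [g [Hg -> <- Hc]]]] E]]]; exists g.
case: (Hg) => gp gc Ht Hk cp; split=> //.
  by split=> //; [exists tau | exists kappa].
by apply/braid_eqP; rewrite (psi_stage Hg) (states_traject Hg Hc).
Qed.

(** Patterns of all lengths keep the orbit inside the finite set of
    bounded states, where it has to come back to a state. *)
Lemma traject_periodic F (c : n.+1.-bseq skeleton) : (forall m, reaches F c m) ->
  exists i p, 0 < p /\
    forall l, i <= l -> iter (l + p) (next_state F) c = iter l (next_state F) c.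
Proof.
move=> H; pose N := #|{: n.+1.-bseq skeleton}|.
have [tau [kappa [g [Hg EF gN Hc]]]] := H N.+1.
have Eg := states_traject Hg Hc; rewrite -EF gN in Eg.
have sz (k : 'I_N.+1) : size (iter k (next_state F) c) <= n.+1.
  by apply: (size_states Hg); rewrite Eg; apply/trajectP; exists k.
pose f (k : 'I_N.+1) := Bseq (sz k).
have /injectivePn[i [j ij Efij]] : ~~ injectiveb f.
  by apply/negP => /injectiveP /leq_card; rewrite card_ord ltnn.
have Eij : iter i (next_state F) c = iter j (next_state F) c by move/(congr1 val): Efij.
wlog {ij Efij} ij : i j Eij / i < j.
  by move: ij; rewrite -val_eqE neq_ltn => /orP[] ij H'; [apply: H' ij|apply: H' ij].
exists i, (j - i); rewrite subn_gt0; split=> // l il.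
rewrite -(subnK il) -addnA (subnKC (ltnW ij)) !iterD.
by rewrite Eij.
Qed.
End Evolution.

(** * Decision procedures *)

Lemma computable_rcons {A : Type} {eA : Encoding A} {B : Type} {eB : Encoding B}
    (s : A -> seq B) (b : A -> B) :
  computable s -> computable b -> computable (fun a => rcons (s a) (b a)).
Proof.
move=> Hs Hb; have H : computable (fun a => s a ++ [:: b a]).
  by refine (computable_cat _ _); computability.
by apply: computable_ext H => a; rewrite cats1.
Qed.

Lemma computable_inv_gen {A : Type} {eA : Encoding A}
    (g : A -> gen) :
  computable g -> computable (fun a => inv_gen (g a)).
Proof.
move=> Hg; refine (computable_pair _ _); first by computability.
by refine (computable_negb _); computability.
Qed.

Lemma computable_push {A : Type} {eA : Encoding A}
    (g : A -> gen) (s : A -> seq gen) :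
  computable g -> computable s -> computable (fun a => push (g a) (s a)).
Proof.
move=> Hg Hs; refine (computable_match_seq (s := s) (f := fun a => [:: g a])
  (g := fun a b t => if b == inv_gen (g a) then t else g a :: s a) Hs _ _).
  by computability.
have Hs' : computable (fun x : A * (gen * seq gen) => s x.1).
  by refine (computable_comp Hs _); computability.
have Hg' : computable (fun x : A * (gen * seq gen) => g x.1).
  by refine (computable_comp Hg _); computability.
refine (computable_if _ _ _); computability.
by refine (computable_eq _ _); computability; apply: computable_inv_gen.
Qed.

Lemma computable_norm {A : Type} {eA : Encoding A}
    (s : A -> seq gen) :
  computable s -> computable (fun a => norm (s a)).
Proof.
move=> Hs; apply: (computable_foldr (g := fun _ => push)) => //; last exact: computable_const.
by apply: computable_push; computability.
Qed.

Lemma computable_artin_gen {A : Type} {eA : Encoding A} (g a : A -> gen) :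
  computable g -> computable a -> computable (fun x => artin_gen (g x) (a x)).
Proof.
move=> Hg Ha.
have H : computable (fun x => if (g x).2 then
    if (a x).1 == (g x).1 then [:: ((g x).1, true); ((g x).1.+1, (a x).2); ((g x).1, false)]
    else if (a x).1 == (g x).1.+1 then [:: ((g x).1, (a x).2)] else [:: a x]
  else
    if (a x).1 == (g x).1 then [:: ((g x).1.+1, (a x).2)]
    else if (a x).1 == (g x).1.+1 then
      [:: ((g x).1.+1, false); ((g x).1, (a x).2); ((g x).1.+1, true)] else [:: a x]).
  have Hg1 : computable (fun x => (g x).1.+1) by apply: computable_succn; computability.
  have E1 : computable (fun x => (a x).1 == (g x).1).
    by apply: computable_eq; computability.
  have E2 : computable (fun x => (a x).1 == (g x).1.+1).
    by apply: computable_eq; computability.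
  refine (computable_if _ _ _); [by computability| |];
    (refine (computable_if _ _ _); [by computability..|]);
    by refine (computable_if _ _ _); computability.
by apply: computable_ext H => x; case: (g x) (a x) => i e [k d].
Qed.

Lemma computable_artin {A : Type} {eA : Encoding A}
    (g : A -> gen) (f : A -> seq gen) :
  computable g -> computable f -> computable (fun x => artin (g x) (f x)).
Proof.
move=> Hg Hf; refine (computable_flatten _).
refine (computable_map (f := fun x => artin_gen (g x)) _ Hf).
apply: computable_artin_gen; last by computability.
by refine (computable_comp Hg _); computability.
Qed.

Lemma computable_comb_step : computable
  (fun x : (nat * (seq gen * seq gen)) * gen => comb_step x.1 x.2).
Proof.
pose j (x : (nat * (seq gen * seq gen)) * gen) := x.1.1.
pose b (x : (nat * (seq gen * seq gen)) * gen) := x.1.2.1.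
pose f (x : (nat * (seq gen * seq gen)) * gen) := x.1.2.2.
pose i (x : (nat * (seq gen * seq gen)) * gen) := x.2.1.
pose e (x : (nat * (seq gen * seq gen)) * gen) := x.2.2.
have Hj : computable j by rewrite /j; computability.
have Hb : computable b by rewrite /b; computability.
have Hf : computable f by rewrite /f; computability.
have Hi : computable i by rewrite /i; computability.
have He : computable e by rewrite /e; computability.
have Hi1 : computable (fun x => (i x).+1) by apply: computable_succn.
pose g x := (if j x < i x then (i x).-1 else i x, e x).
have Hg : computable g.
  refine (computable_pair _ He); refine (computable_if _ _ Hi).
    by refine (computable_leq _ Hi); apply: computable_succn.
  exact: computable_predn.
have H : computable (fun x =>
    if (i x).+1 == j x then (i x, (b x, if e x then f x else rcons (f x) (i x, false)))
    else if i x == j x then ((i x).+1, (b x, if e x then rcons (f x) (i x, true) else f x))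
    else (j x, (rcons (b x) (g x), artin (g x) (f x)))).
  refine (computable_if _ _ _); first exact: computable_eq.
    computability; refine (computable_if _ _ _) => //.
    by apply: computable_rcons => //; computability.
  refine (computable_if _ _ _); first exact: computable_eq.
    computability; refine (computable_if _ _ _) => //.
    by apply: computable_rcons => //; computability.
  by computability; [apply: computable_rcons | apply: computable_artin].
by apply: computable_ext H => -[[j' [b' f']] [i' e']].
Qed.

Lemma computable_combed {A : Type} {eA : Encoding A} m (w : A -> seq gen) :
  computable w -> computable (fun a => combed m (w a)).
Proof.
elim: m A eA w => [|m IH] A eA w Hw; first exact: computable_const.
have Hc : computable (fun a => comb (m.+1, ([::], [::])) (w a)).
  apply: (computable_foldl (g := fun _ => comb_step)) => //; last exact: computable_const.
  by refine (computable_comp computable_comb_step _); computability.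
pose st a := comb (m.+1, ([::], [::])) (w a).
have H : computable (fun a => ((st a).1, norm (st a).2.2) :: combed m (st a).2.1).
  computability; last by apply: IH; computability.
  by apply: computable_norm; computability.
by apply: computable_ext H => a; rewrite /st /=; case: (comb _ _) => j [b f].
Qed.

Lemma computable_pow {A : Type} {eA : Encoding A} v (k : A -> nat) :
  computable k -> computable (fun a => pow v (k a)).
Proof.
move=> Hk; have H : computable (fun x : A * seq gen => v ++ x.2).
  by refine (computable_cat _ _); computability.
apply: computable_ext (computable_iter (g := fun _ => cat v) Hk (computable_const [::]) H).
by move=> a; elim: (k a) => //= i ->.
Qed.

Local Open Scope group_scope.

Definition inv_word (w : seq gen) : seq gen := rev (map inv_gen w).

Lemma eval_inv_word (G : groupType) (x : nat -> G) w : eval x (inv_word w) = (eval x w)^-1.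
Proof.
elim: w => [|a w IH] /=; first by rewrite invg1.
by rewrite /inv_word /= rev_cons eval_rcons -/(inv_word w) IH eval_inv_gen invgM.
Qed.

Lemma bounded_inv_word m w : bounded m (inv_word w) = bounded m w.
Proof. by rewrite /bounded /inv_word all_rev all_map. Qed.

(** Write k = k' q + r with [q] given by [power_growth].  If v^q is trivial, [r] is
    an exponent as well; otherwise k' is bounded in terms of v^(q k') = (u v^r)^-1 w z^-1. *)
Lemma exponent_bound m u v z : bounded m u -> bounded m v -> bounded m z ->
  exists q c D, forall w, bounded m w ->
  (exists k, braid_equiv m (u ++ pow v k ++ z) w) ->
  exists2 k, k < q * (4 ^ (size w + c) + D) & braid_equiv m (u ++ pow v k ++ z) w.
Proof.
move=> um vm zm; have [q [D [q_gt0 H]]] := power_growth vm.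
exists q, (size u + q * size v + size z)%N, D.+1 => w wm [k Hk].
have kE := divn_eq k q; set k' := k %/ q in kE; set r := k %% q in kE.
have rq : r < q by rewrite ltn_mod.
case: H => [v1|H].
  exists r.
    by apply: leq_trans rq _; rewrite leq_pmulr // addnS.
  apply/braid_equivP => G s Hs; move/braid_equivP/(_ G s Hs): Hk => <-.
  rewrite !eval_cat !eval_pow kE mulnC expgnDr expgnA.
  by move/braid_equivP/(_ G s Hs): v1; rewrite eval_pow /= => ->; rewrite expg1n mul1g.
exists k => //.
have Hx : braid_equiv m (pow v (q * k')) (inv_word (u ++ pow v r) ++ w ++ inv_word z).
  apply/braid_equivP => G s Hs; move/braid_equivP/(_ G s Hs): Hk.
  rewrite !eval_cat !eval_inv_word !eval_cat => <-; rewrite kE addnC powD mulnC.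
  by rewrite !eval_cat -!mulgA mulgV mulg1 invgM -!mulgA mulKg mulKg.
have := H k' _ _ Hx; rewrite !bounded_cat !bounded_inv_word bounded_cat um wm zm.
rewrite bounded_pow // => /(_ isT) k'_le.
have sz : size (inv_word (u ++ pow v r) ++ w ++ inv_word z) <=
    size w + (size u + q * size v + size z).
  rewrite /inv_word !size_cat !size_rev !size_map !size_cat.
  rewrite /pow size_flatten /shape map_nseq sumn_nseq.
  have : size v * r <= q * size v by rewrite mulnC leq_mul2r (ltnW rq) orbT.
  lia.
have k'_le2 : k' <= 4 ^ (size w + (size u + q * size v + size z)) + D.
  by apply: leq_trans k'_le _; rewrite leq_add2r leq_exp2l.
rewrite kE; move: k'_le2; set B := (4 ^ _)%N => k'_le2.
apply: (@leq_trans (q * k'.+1)%N); first by rewrite mulnS mulnC; lia.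
by rewrite leq_mul2l; apply/orP; right; lia.
Qed.

(** Restricted to the words of the braid group with [m] generators, on which
    combed forms determine braids. *)
Definition decides m (f : seq gen -> bool) (Q : seq gen -> Prop) : Prop :=
  computable f /\ forall w, bounded m w -> (f w <-> Q w).

Lemma decides_powers m u v z : bounded m u -> bounded m v -> bounded m z ->
  exists f, decides m f (fun w => exists k, braid_equiv m (u ++ pow v k ++ z) w).
Proof.
move=> um vm zm; have [q [c [D H]]] := exponent_bound um vm zm.
pose B (w : seq gen) := iter q (addn (4 ^ (size w + c) + D)) 0%N.
exists (fun w => has (fun k => combed m (u ++ pow v k ++ z) == combed m w) (iota 0 (B w))).
split.
  apply: computable_has.
    apply: computable_eq; apply: computable_combed; last by computability.
    refine (computable_cat _ _); first by computability.
    refine (computable_cat _ _); last by computability.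
    by refine (computable_pow _ _); computability.
  apply: computable_iota; apply: (computable_iter (g := fun w => addn (4 ^ (size w + c) + D)));
    try exact: computable_const.
  refine (computable_addn _ _); last by computability.
  refine (computable_addn _ _); last by computability.
  apply: computable_expn; refine (computable_addn _ _); last by computability.
  by refine (computable_size _); computability.
have BE w : B w = (q * (4 ^ (size w + c) + D))%N by rewrite /B iter_addn_0 mulnC.
move=> w wm; split.
  case/hasP=> k _ /eqP E; exists k; apply: combed_eq_braid_equiv E => //.
  by rewrite !bounded_cat um bounded_pow.
case/(H w wm) => k kB E; apply/hasP; exists k; first by rewrite mem_iota BE.
by apply/eqP; apply: combed_braid_equiv E.
Qed.

Lemma decides_ext m f (P Q : seq gen -> Prop) :
  (forall w, P w <-> Q w) -> decides m f P -> decides m f Q.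
Proof. by move=> PQ [Hf H]; split=> // w wm; rewrite H // PQ. Qed.

Lemma decides_exists m (I : eqType) (r : seq I) (Q : I -> seq gen -> Prop) :
  (forall i, i \in r -> exists f, decides m f (Q i)) ->
  exists f, decides m f (fun w => exists2 i, i \in r & Q i w).
Proof.
elim: r => [|i r IH] H.
  by exists (fun=> false); split; [exact: computable_const | move=> w _; split=> // -[]].
have [f [Hf Df]] := H i (mem_head _ _).
have [|g [Hg Dg]] := IH; first by move=> j jr; apply: H; rewrite inE jr orbT.
exists (fun w => f w || g w); split; first exact: computable_orb.
move=> w wm; split.
  case/orP => [/(Df w wm) Qi|/(Dg w wm) [j jr Qj]]; first by exists i; rewrite ?mem_head.
  by exists j; rewrite // inE jr orbT.
case=> j; rewrite inE => /orP[/eqP -> /(Df w wm) -> //|jr Qj].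
by apply/orP; right; apply/(Dg w wm); exists j.
Qed.

Local Close Scope group_scope.

Lemma decides_powers_seq m (r : seq (seq gen * (seq gen * seq gen))) :
  (forall x, x \in r -> [/\ bounded m x.1, bounded m x.2.1 & bounded m x.2.2]) ->
  exists f, decides m f (fun w => exists2 x, x \in r &
    exists k, braid_equiv m (x.1 ++ pow x.2.1 k ++ x.2.2) w).
Proof.
by move=> H; apply: decides_exists => x /H[um vm zm]; apply: decides_powers.
Qed.

Lemma pow_nil k : pow [::] k = [::].
Proof. by elim: k. Qed.

Section Stages.
Variables (F : {ffun skeleton * skeleton -> skeleton}).

Lemma stageD c a b : stage F c (a + b) = stage F c a ++ stage F (iter a (next_state F) c) b.
Proof. by rewrite /stage trajectD map_cat flatten_cat. Qed.

Lemma stage_loop c p k : iter p (next_state F) c = c ->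
  stage F c (k * p) = pow (stage F c p) k.
Proof. by move=> cp; elim: k => //= k IH; rewrite mulSn stageD cp IH. Qed.

Lemma stage_eventually_periodic c i p k r :
  iter p (next_state F) (iter i (next_state F) c) = iter i (next_state F) c ->
  let s := iter i (next_state F) c in
  stage F c (i + (k * p + r)) = stage F c i ++ pow (stage F s p) k ++ stage F s r.
Proof.
move=> loop s; rewrite !stageD stage_loop //; congr (_ ++ (_ ++ stage F _ r)).
by elim: k => //= k IH; rewrite mulSn addnC iterD loop.
Qed.
End Stages.

Section Decision.
Variable n : nat.
Hypothesis n_gt0 : 0 < n.

Lemma stage_bounded F c m : reaches n F c m -> bounded n.-1 (stage F c m).
Proof.
case=> tau [kappa [g [Hg -> <- Hc]]].
by rewrite /stage -(states_traject Hg Hc) -(psi_stage Hg); apply: gens_bounded.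
Qed.

(** Whether the lengths of the patterns are bounded is settled classically:
    in either case some recursive function decides the problem. *)
Lemma decides_stages F (c : n.+1.-bseq skeleton) : exists f, decides n.-1 f
  (fun w => exists m, reaches n F c m /\ braid_equiv n.-1 (stage F c m) w).
Proof.
have [all_m|/existsNP[M notM]] := pselect (forall m, reaches n F c m).
  have [i [p [p_gt0 per]]] := traject_periodic n_gt0 all_m.
  pose s := iter i (next_state F) c.
  have loop : iter p (next_state F) s = s by rewrite -iterD addnC per.
  pose r := [seq (stage F c m, ([::], [::])) | m <- iota 0 i] ++
            [seq (stage F c i, (stage F s p, stage F s l)) | l <- iota 0 p].
  have [|f Hf] := @decides_powers_seq n.-1 r.
    have s_bounded l : bounded n.-1 (stage F s l).
      by have := stage_bounded (all_m (i + l)); rewrite stageD bounded_cat => /andP[].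
    by move=> x; rewrite mem_cat => /orP[] /mapP[l _ ->] /=; split=> //; apply: stage_bounded.
  exists f; apply: decides_ext Hf => w; split.
    case=> x; rewrite mem_cat => /orP[] /mapP[l _ ->] /= [k].
      by rewrite pow_nil !cats0 => E; exists l.
    by rewrite -(stage_eventually_periodic k l loop) => E; exists (i + (k * p + l)).
  case=> m [_ E]; have [mi|im] := ltnP m i.
    exists (stage F c m, ([::], [::])).
      by rewrite mem_cat; apply/orP; left; apply/mapP; exists m; rewrite ?mem_iota.
    by exists 0; rewrite /= cats0.
  exists (stage F c i, (stage F s p, stage F s ((m - i) %% p))).
    rewrite mem_cat; apply/orP; right; apply/mapP; exists ((m - i) %% p) => //.
    by rewrite mem_iota ltn_mod.
  exists ((m - i) %/ p); rewrite /= -(stage_eventually_periodic _ _ loop).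
  by rewrite -divn_eq subnKC.
pose r := [seq (stage F c m, (([::] : seq gen), ([::] : seq gen))) |
  m <- iota 0 M & `[< reaches n F c m >]].
have [|f Hf] := @decides_powers_seq n.-1 r.
  move=> x /mapP[m]; rewrite mem_filter => /andP[/asboolP mr _] -> /=.
  by split=> //; apply: stage_bounded.
exists f; apply: decides_ext Hf => w; split.
  case=> x /mapP[m]; rewrite mem_filter => /andP[/asboolP mr _] -> /= [k].
  by rewrite pow_nil !cats0 => E; exists m.
case=> m [mr E]; exists (stage F c m, ([::], [::])); last first.
  by exists 0; rewrite /= cats0.
apply/mapP; exists m => //; rewrite mem_filter; apply/andP; split; first exact/asboolP.
rewrite mem_iota ltnNge /=; apply/negP => Mm.
exact/notM/(reaches_leq Mm).
Qed.

Lemma decides_representation : exists f, decides n.-1 f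
  (fun u => exists F (c : n.+1.-bseq skeleton) m,
     reaches n F c m /\ braid_equiv n.-1 (stage F c m) u).
Proof.
pose key := ({ffun skeleton * skeleton -> skeleton} * n.+1.-bseq skeleton)%type.
have [|f Hf] := @decides_exists n.-1 key (enum {: key})
  (fun k w => exists m, reaches n k.1 k.2 m /\ braid_equiv n.-1 (stage k.1 k.2 m) w).
  by move=> [F c] _; apply: decides_stages.
exists f; apply: decides_ext Hf => w; split.
  by case=> [[F c] _ [m H]]; exists F, c, m.
by case=> [F [c [m H]]]; exists (F, c); rewrite ?mem_enum //; exists m.
Qed.
End Decision.

Theorem corollary4p4 (n : nat) (n_gt0 : 0 < n) :
  decidable_problem (@word_code n) (@has_compact_SCA_representation n).
Proof.
have [f [Hf Df]] := decides_representation n_gt0.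
have Hd : computable (fun s : seq nat => f [seq (k./2, ~~ odd k) | k <- s]).
  refine (computable_comp Hf _).
  refine (computable_map (f := fun _ k => (k./2, ~~ odd k)) _ _).
    refine (computable_pair _ _).
      by refine (computable_half _); computability.
    by refine (computable_negb _); refine (computable_odd _); computability.
  exact: computable_id.
have [r Hr] := Hd; exists r => w; exists (f (gens w)).
split; last by rewrite (Df _ (gens_bounded w)) representationP.
have := Hr [seq letter_code l | l <- w].
rewrite /enc /= /enc_seq map_id -map_comp -/(word_code w); congr computes.
congr (nat_of_bool (f _)); apply: eq_map => -[t []] /=.
  by rewrite doubleK odd_double.
by rewrite uphalf_double odd_double.
Qed.
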